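(* Let $\mathcal M^1_{K_3}$ (resp. $\mathcal M^2_{K_3}$) be the graph property of being Maker's win in the $(1:1)$ Maker-Breaker vertex $K_3$-game where Maker moves first (resp. second). For the random graph process $\tilde G$ on $n$ vertices, w.h.p. $\tau(\tilde G,\mathcal M^1_{K_3})=\tau(\tilde G,\mathcal G_{DD})$ and $\tau(\tilde G,\mathcal M^2_{K_3})=\tau(\tilde G,\mathcal G_{2DD})$.
   Context: The $(1:1)$ Maker-Breaker vertex $K_3$-game on a graph $G$: Maker and Breaker alternately claim one previously unclaimed vertex of $G$ each until all vertices are claimed; Maker wins if the subgraph of $G$ induced by his vertices contains a triangle, otherwise Breaker wins. The random graph process on $[n]$: order the $m=\binom n2$ edges of $K_n$ by a uniformly random permutation and let $G_i$ be the graph on $[n]$ with the first $i$ edges, $\tilde G=(G_i)_{i=0}^m$. For a monotone increasing property $\mathcal P$, $\tau(\tilde G,\mathcal P)=\min\{i: G_i\in\mathcal P\}$. A double diamond $DD$ is the graph on vertices $x,y_1,z_1,z_2,y_2,z_3,z_4$ with edges $xy_1,xz_1,xz_2,y_1z_1,y_1z_2,xy_2,xz_3,xz_4,y_2z_3,y_2z_4$ (two copies of $K_4$ minus an edge, sharing the single vertex $x$). For a graph $F$ and integer $k$, $\mathcal G_{kF}$ is the property of containing $k$ (possibly intersecting) copies of $F$, and $\mathcal G_F=\mathcal G_{1F}$. ''W.h.p.'' means with probability tending to 1 as $n\to\infty$. *)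

(* Defs.v *)
From HB Require Import structures.
From mathcomp Require Import all_boot all_order all_algebra all_fingroup.
Set Implicit Arguments. Unset Strict Implicit. Unset Printing Implicit Defensive.
Import Order.TTheory GRing.Theory Num.Theory.

(* Graphs on vertex set [n] = 'I_n are symmetric irreflexive relations. *)

Definition Kedges (n : nat) : seq (nat * nat) :=
  [seq (i, j) | i <- iota 0 n, j <- [seq j <- iota 0 n | i < j]].
Definition nedges (n : nat) : nat := size (Kedges n).

(* Random graph process: a uniformly random permutation sigma of the edge
   indices; edge number k comes at position sigma k. G_i consists of the edges
   whose position is < i (i.e. the first i edges of the random ordering). *)
Definition Gproc (n : nat) (sigma : {perm 'I_(nedges n)}) (i : nat) : rel 'I_n :=
  fun x y => [exists k : 'I_(nedges n),
    (val (sigma k) < i) &&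
    ((nth (0, 0) (Kedges n) k == (val x, val y)) ||
     (nth (0, 0) (Kedges n) k == (val y, val x)))].

Definition gprop := forall n : nat, rel 'I_n -> bool.

(* tau(G~, P) = min { i : G_i in P }; (defaults to m+1 if never satisfied). *)
Definition tau (P : gprop) (n : nat) (sigma : {perm 'I_(nedges n)}) : nat :=
  find (fun i => P n (Gproc sigma i)) (iota 0 (nedges n).+1).

Definition has_triangle (n : nat) (G : rel 'I_n) (M : {set 'I_n}) : bool :=
  [exists x, exists y, exists z,
    [&& x \in M, y \in M, z \in M, G x y, G y z & G x z]].

Fixpoint mb_win (n : nat) (G : rel 'I_n) (fuel : nat) (maker_to_move : bool)
    (M B : {set 'I_n}) : bool :=
  match fuel with
  | 0 => has_triangle G M
  | f.+1 =>
    if ~~ [exists v, (v \notin M) && (v \notin B)] then has_triangle G M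
    else if maker_to_move then
      [exists v, [&& v \notin M, v \notin B & mb_win G f false (v |: M) B]]
    else
      [forall v, ((v \notin M) && (v \notin B)) ==> mb_win G f true M (v |: B)]
  end.

Definition Maker1 : gprop := fun n G => mb_win G n true set0 set0.
Definition Maker2 : gprop := fun n G => mb_win G n false set0 set0.

Definition embeds (p n : nat) (F : rel 'I_p) (G : rel 'I_n) (f : {ffun 'I_p -> 'I_n}) : bool :=
  injectiveb f && [forall u, forall v, F u v ==> G (f u) (f v)].
Definition copy_of (p n : nat) (F : rel 'I_p) (f : {ffun 'I_p -> 'I_n}) : {set 'I_n * 'I_n} :=
  [set e | [exists u, exists v, F u v && (e == (f u, f v))]].

Definition contains_k (p : nat) (F : rel 'I_p) (k : nat) : gprop :=
  fun n G => [exists fs : {ffun 'I_k -> {ffun 'I_p -> 'I_n}},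
    [forall i, embeds F G (fs i)] &&
    [forall i, forall j, (i != j) ==> (copy_of F (fs i) != copy_of F (fs j))]].

(* Double diamond on x=0,y1=1,z1=2,z2=3,y2=4,z3=5,z4=6. *)
Definition DD_edges : seq (nat * nat) :=
  [:: (0,1); (0,2); (0,3); (1,2); (1,3); (0,4); (0,5); (0,6); (4,5); (4,6)].
Definition DD : rel 'I_7 :=
  fun u v => ((val u, val v) \in DD_edges) || ((val v, val u) \in DD_edges).

Definition whp (E : forall n : nat, {perm 'I_(nedges n)} -> bool) : Prop :=
  forall eps : rat, (0 < eps)%R -> exists N : nat, forall n : nat, (N <= n)%N ->
    (1 - eps <= (#|[set s | E n s]|%:R / #|{perm 'I_(nedges n)}|%:R : rat))%R.

(* Main.v *)
Require Import Defs.
From HB Require Import structures.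
From mathcomp Require Import all_boot all_order all_algebra all_fingroup.
From mathcomp Require Import zify ring lra.
Set Implicit Arguments. Unset Strict Implicit. Unset Printing Implicit Defensive.
Import Order.TTheory GRing.Theory Num.Theory.

(** Let G_m be the process at time m = w t^13, where t^10 <= n < (t+1)^10 and w
    is a large constant, so that the edge density is of order n^(-7/10). A first
    moment bound shows that w.h.p. every set S of at most 23 vertices spans at
    most 10|S|/7 edges of G_m, and a second moment bound that w.h.p. G_m contains
    two copies of DD; as DD is strictly balanced, sparsity makes distinct copies
    vertex disjoint. From time m on Maker therefore wins both games.

    Before time m the graph is sparse as well. Grow a set S of vertices by
    adjoining triangles that meet it: the excess 10|S| - 7e(S) starts at 9, or at
    5 if one starts from a diamond, drops by at least 1 for a triangle meeting S
    in one vertex and by at least 4 for a triangle meeting S in an edge, and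
    never becomes negative. Hence S soon absorbs every triangle that meets it,
    and in the few possible cases the triangles inside S can be covered by
    pairwise disjoint pairs of vertices, unless S contains a DD. So if there is
    no DD then Breaker wins as second player by pairing, and if there is a single
    DD then Breaker, playing first, starts with a vertex of it. *)

(** * Triangle clusters in sparse graphs *)

Section Pairings.
Variables (T : finType) (G : rel T).

(** Arcs are ordered pairs, so each edge of a symmetric loopless graph counts twice and [narcs S] is
    2e(S). *)
Definition arcs (S : {set T}) : {set T * T} :=
  [set e | [&& e.1 \in S, e.2 \in S & G e.1 e.2]].

Definition narcs (S : {set T}) : nat := #|arcs S|.

(** In terms of edges this is 7e(S) <= 10|S|: no small set is denser than DD, which has 10 edges on
    7 vertices. *)
Definition sparse (K : nat) :=
  forall S : {set T}, #|S| <= K -> 7 * narcs S <= 20 * #|S|.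

Definition tri (x y z : T) := [&& G x y, G y z & G x z].

(** Two of the three vertices are partners, so a Breaker who answers each vertex by its partner
    never loses the triangle. As [p] will be an involution, three of the six ordered tests
    suffice. *)
Definition cov (p : T -> T) (x y z : T) := [|| p x == y, p y == z | p x == z].

Definition covers (p : T -> T) (S : {set T}) :=
  forall x y z, x \in S -> y \in S -> z \in S -> tri x y z -> cov p x y z.

(** Fixed points are the vertices without partner. As nothing outside [S] moves, pairings of
    disjoint sets can be glued. *)
Definition pairing (p : T -> T) (S : {set T}) :=
  [/\ involutive p, forall x, x \notin S -> p x = x & covers p S].

Definition is_DD (x y1 z1 z2 y2 z3 z4 : T) :=
  [&& uniq [:: x; y1; z1; z2; y2; z3; z4],
      G x y1, G x z1, G x z2, G y1 z1, G y1 z2,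
      G x y2, G x z3, G x z4, G y2 z3 & G y2 z4].

Hypotheses (Gsym : symmetric G) (Girr : irreflexive G).

Lemma adj_neq x y : G x y -> x != y.
Proof. by apply: contraTneq => ->; rewrite Girr. Qed.

Lemma arcs_setU1 a (S : {set T}) (D : seq T) : a \notin S -> uniq D ->
  {in D, forall y, (y \in S) && G a y} ->
  narcs S + 2 * size D <= narcs (a |: S).
Proof.
move=> aS uD hD.
have cD : #|[set y in D]| = size D by rewrite cardsE; apply/card_uniqP.
pose L := [set (a, y) | y in [set y in D]]; pose R := [set (y, a) | y in [set y in D]].
have cL : #|L| = size D by rewrite card_imset ?cD // => y z [].
have cR : #|R| = size D by rewrite card_imset ?cD // => y z [].
have dLR : [disjoint L & R].
  apply/pred0P => -[y z] /=; apply/negbTE/negP=> /andP[/imsetP[u _ [-> ->]]].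
  case/imsetP => w; rewrite inE => /hD /andP[wS _] [ew _].
  by rewrite -ew (negPf aS) in wS.
have dS : [disjoint arcs S & L :|: R].
  apply/pred0P => -[y z] /=; apply/negbTE/negP; rewrite !inE /= => /andP[/and3P[yS zS _]].
  case/orP => /imsetP[u _ [ey ez]]; first by rewrite -ey yS in aS.
  by rewrite -ez zS in aS.
rewrite /narcs; have -> : #|arcs S| + 2 * size D = #|arcs S :|: (L :|: R)|.
  rewrite cardsU (disjoint_setI0 dS) cards0 subn0 cardsU (disjoint_setI0 dLR).
  by rewrite cards0 subn0 cL cR mul2n addnn.
apply: subset_leq_card; apply/subsetP => -[y z]; rewrite !inE /=.
case/orP => [/and3P[-> -> ->]|]; first by rewrite !orbT.
case/orP => /imsetP[u]; rewrite inE => /hD /andP[uS Gu] [-> ->].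
  by rewrite eqxx uS Gu orbT.
by rewrite eqxx uS Gsym Gu orbT.
Qed.

Lemma tri_rot x y z : tri x y z -> tri y z x.
Proof. by case/and3P=> xy yz xz; apply/and3P; split; rewrite // Gsym. Qed.

Lemma tri_swap x y z : tri x y z -> tri y x z.
Proof. by case/and3P=> xy yz xz; apply/and3P; split; rewrite // Gsym. Qed.

Lemma cov_rot p x y z : involutive p -> cov p x y z -> cov p y z x.
Proof.
move=> pK /or3P[] /eqP e; apply/or3P.
- by apply: Or33; rewrite -e pK.
- by apply: Or31; rewrite e.
by apply: Or32; rewrite -e pK.
Qed.

Lemma cov_swap p x y z : involutive p -> cov p x y z -> cov p y x z.
Proof.
move=> pK /or3P[] /eqP e; apply/or3P.
- by apply: Or31; rewrite -e pK.
- by apply: Or33; rewrite e.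
by apply: Or32; rewrite e.
Qed.

(** Triangles have distinct vertices, so one through [a] has its other two vertices in [S];
    rotations and swaps bring [a] to the front. *)
Lemma covers_setU1 p a (S : {set T}) : involutive p -> covers p S ->
  (forall w w', w \in S -> w' \in S -> tri a w w' -> cov p a w w') ->
  covers p (a |: S).
Proof.
move=> pK cS ca x y z; rewrite !in_setU1.
have two u v w : tri u v w -> [&& u != v, v != w & u != w].
  by case/and3P=> /adj_neq-> /adj_neq-> /adj_neq->.
case: eqP => [->|_] /=.
  move=> _ + + t; have /and3P[n1 n2 n3] := two _ _ _ t.
  by rewrite ![_ == a]eq_sym (negPf n1) (negPf n3) /= => yS zS; apply: ca.
case: (y =P a) => [->|_] /=.
  move=> xS _ + t; have /and3P[n1 n2 n3] := two _ _ _ t.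
  rewrite eq_sym (negPf n2) /= => zS.
  by apply: cov_swap => //; apply: ca => //; apply: tri_swap.
case: (z =P a) => [->|_] /= xS yS.
  by move=> _ t; apply: cov_rot => //; apply: ca => //; do 2!apply: tri_rot.
by move=> zS; apply: cS.
Qed.

(** Adds the pair {u, v}; the result is again an involution when [p] is one that fixes [u] and
    [v]. *)
Definition pswap (p : T -> T) (u v : T) (x : T) :=
  if x == u then v else if x == v then u else p x.

Lemma pswapL p u v : pswap p u v u = v. Proof. by rewrite /pswap eqxx. Qed.

Lemma pswap_inv p u v : involutive p -> p u = u -> p v = v ->
  involutive (pswap p u v).
Proof.
move=> pK pu pv x; rewrite /pswap.
case: (x =P u) => [->|nu]; first by rewrite eqxx; case: eqP.
case: (x =P v) => [->|nv]; first by rewrite eqxx.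
case: eqP => [e|_]; first by case: nu; rewrite -(pK x) e pu.
case: eqP => [e|_]; first by case: nv; rewrite -(pK x) e pv.
exact: pK.
Qed.

Lemma pswap_cov p u v x y z : p u = u -> p v = v -> tri x y z ->
  cov p x y z -> cov (pswap p u v) x y z.
Proof.
move=> pu pv /and3P[/adj_neq xy /adj_neq yz /adj_neq xz] c.
have keep w w' : w != w' -> p w == w' -> pswap p u v w == w'.
  move=> ne /eqP e; rewrite /pswap; case: (w =P u) => [wu|_].
    by rewrite -e wu pu eqxx in ne.
  case: (w =P v) => [wv|_]; first by rewrite -e wv pv eqxx in ne.
  exact/eqP.
by case/or3P: c => /keep c; apply/or3P; [apply: Or31|apply: Or32|apply: Or33]; apply: c.
Qed.

(** The triangle at [v] brings three edges, hence 6 arcs, and every [y] in [D] one more edge from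
    [a]. *)
Lemma arcs_vertex_step v a b (S : {set T}) (D : seq T) :
  v \in S -> a \notin S -> b \notin S -> tri v a b ->
  uniq D -> v \notin D -> {in D, forall y, (y \in S) && G a y} ->
  narcs S + 6 + 2 * size D <= narcs (a |: (b |: S)).
Proof.
move=> vS aS bS /and3P[va ab vb] uD vD hD.
have bv : narcs S + 2 * size [:: v] <= narcs (b |: S).
  by apply: arcs_setU1 => // y; rewrite inE => /eqP->; rewrite vS Gsym.
have av : narcs (b |: S) + 2 * size [:: b, v & D] <= narcs (a |: (b |: S)).
  apply: arcs_setU1 => /=.
  - by rewrite in_setU1 negb_or aS adj_neq.
  - rewrite vD uD inE negb_or eq_sym adj_neq //= !andbT.
    by apply/negP=> /hD; rewrite (negPf bS).
  move=> y; rewrite !inE; case: eqP => [-> _|_] /=; first by rewrite ab.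
  case: eqP => [-> _|_ /hD //]; by rewrite vS Gsym va.
by clear -bv av; move: bv av => /=; lia.
Qed.

Lemma card_vertex_step a b (S : {set T}) : a \notin S -> b \notin S -> a != b ->
  #|a |: (b |: S)| = #|S| + 2.
Proof.
move=> aS bS ab; rewrite cardsU1 in_setU1 negb_or ab aS cardsU1 bS /=; lia.
Qed.

(** A triangle through [a] with two vertices in [S] gives [a] extra edges into [S]. Two of them make
    10 new arcs on 2 new vertices, forcing 70 <= 40 + c. If [v] is on the triangle there is only
    one, forcing 56 <= 40 + c; hence the alternative between c < 16 and a direct exclusion. *)
Lemma vertex_step_no_new v a b w w' (S : {set T}) c :
  sparse 23 -> v \in S -> a \notin S -> b \notin S -> tri v a b ->
  20 * #|S| <= 7 * narcs S + c -> #|S| <= 21 -> c <= 18 ->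
  (c < 16 \/ forall u, u \in S -> G v u -> ~~ G a u) ->
  w \in S -> w' \in S -> tri a w w' -> False.
Proof.
move=> sp vS aS bS t ex cS c18 hc wS w'S /and3P[aw ww' aw'].
have ab : a != b by case/and3P: t => _ /adj_neq.
have cc := card_vertex_step aS bS ab.
have sp' : 7 * narcs (a |: (b |: S)) <= 20 * (#|S| + 2).
  by rewrite -cc; apply: sp; rewrite cc addn2 !ltnS.
have hv u u' : u \in S -> u' \in S -> v = u -> G u u' -> G a u' -> False.
  move=> uS u'S evu uu' au'; rewrite -evu in uu'.
  case: hc => [c16|/(_ u' u'S uu')]; last by rewrite au'.
  have := @arcs_vertex_step v a b S [:: u'] vS aS bS t erefl.
  rewrite inE adj_neq // => /(_ isT) h.
  have : narcs S + 6 + 2 * size [:: u'] <= narcs (a |: (b |: S)).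
    by apply: h => y; rewrite inE => /eqP->; rewrite u'S.
  clear -sp' ex c16 => /=; lia.
have [e|nw] := eqVneq v w; first exact: (hv w w').
have [e|nw'] := eqVneq v w'; first by apply: (hv w' w) => //; rewrite Gsym.
have : narcs S + 6 + 2 * size [:: w; w'] <= narcs (a |: (b |: S)).
  apply: (@arcs_vertex_step v) => //=.
  - by rewrite inE adj_neq.
  - by rewrite !inE negb_or nw.
  by move=> y; rewrite !inE => /orP[]/eqP->; rewrite ?wS ?w'S.
clear -sp' ex c18 => /=; lia.
Qed.

Lemma tri_swap23 x y z : tri x y z -> tri x z y.
Proof. by case/and3P=> xy yz xz; apply/and3P; split; rewrite // Gsym. Qed.

(** New triangles contain both [a] and [b], by the count of edges applied to each of them, so it
    suffices to pair [a] with [b]. *)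
Lemma pairing_vertex_step p v a b (S : {set T}) c :
  sparse 23 -> pairing p S -> v \in S -> a \notin S -> b \notin S -> tri v a b ->
  20 * #|S| <= 7 * narcs S + c -> #|S| <= 21 -> c <= 18 ->
  (c < 16 \/ forall u, u \in S -> G v u -> ~~ G a u && ~~ G b u) ->
  pairing (pswap p a b) (a |: (b |: S)).
Proof.
move=> sp [pK fp cp] vS aS bS t ex cS c18 hc.
have pa := fp _ aS; have pb := fp _ bS.
have qK := pswap_inv pK pa pb.
split=> // [x|].
  rewrite !in_setU1 !negb_or => /and3P[xa xb xS].
  by rewrite /pswap (negPf xa) (negPf xb) fp.
apply: covers_setU1 => //; first apply: covers_setU1 => //.
- by move=> x y z xS yS zS t'; apply: pswap_cov => //; apply: cp.
- move=> w w' wS w'S t'; case: (@vertex_step_no_new v b a w w' S c) => //.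
    exact: tri_swap23.
  by case: hc => [|h]; [left|right=> u uS vu; case/andP: (h u uS vu)].
move=> w w'; rewrite !in_setU1.
case: (w =P b) => [-> _ _ _|_ /= wS]; first by rewrite /cov pswapL eqxx.
case: (w' =P b) => [-> _ _|_ /= w'S t']; first by rewrite /cov pswapL eqxx ?orbT.
case: (@vertex_step_no_new v a b w w' S c) => //.
by case: hc => [|h]; [left|right=> u uS vu; case/andP: (h u uS vu)].
Qed.

Lemma arcs_edge_step u v e (S : {set T}) :
  u \in S -> v \in S -> e \notin S -> tri u v e ->
  narcs S + 4 <= narcs (e |: S).
Proof.
move=> uS vS eS /and3P[uv ve ue].
have -> : 4 = 2 * size [:: u; v] by [].
apply: arcs_setU1 => //=; first by rewrite inE adj_neq.
by move=> y; rewrite !inE => /orP[]/eqP->; rewrite ?uS ?vS Gsym.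
Qed.

(** A third neighbour of [e] in [S] would make 6 new arcs on one new vertex, forcing 42 <= 20 +
    c. *)
Lemma edge_step_no_new u v e w (S : {set T}) c :
  sparse 23 -> u \in S -> v \in S -> e \notin S -> tri u v e ->
  20 * #|S| <= 7 * narcs S + c -> #|S| <= 22 -> c <= 18 ->
  w \in S -> G e w -> (w == u) || (w == v).
Proof.
move=> sp uS vS eS /and3P[uv ve ue] ex cS c18 wS ew.
apply: contraT; rewrite negb_or => /andP[wu wv].
have : narcs S + 2 * size [:: w; u; v] <= narcs (e |: S).
  apply: arcs_setU1 => //=; first by rewrite !inE negb_or wu wv adj_neq.
  by move=> y; rewrite !inE => /or3P[]/eqP->; rewrite ?uS ?vS ?wS // Gsym.
have sp' : 7 * narcs (e |: S) <= 20 * (1 + #|S|).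
  by have := sp (e |: S); rewrite cardsU1 eS; apply.
clear -sp' ex c18 => /=; lia.
Qed.

(** The only new triangle is [u v e]. It is covered already if [u] and [v] are partners; otherwise
    the free vertex [u] is paired with [e]. *)
Lemma pairing_edge_step p u v e (S : {set T}) c :
  sparse 23 -> pairing p S -> u \in S -> v \in S -> e \notin S -> tri u v e ->
  20 * #|S| <= 7 * narcs S + c -> #|S| <= 22 -> c <= 18 ->
  (p u == v) || (p u == u) -> exists q, pairing q (e |: S).
Proof.
move=> sp [pK fp cp] uS vS eS t ex cS c18 hp.
have new w w' : w \in S -> w' \in S -> tri e w w' ->
    (w == u) && (w' == v) || (w == v) && (w' == u).
  move=> wS w'S /and3P[ew /adj_neq ww' ew'].
  have := edge_step_no_new sp uS vS eS t ex cS c18 wS ew.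
  have := edge_step_no_new sp uS vS eS t ex cS c18 w'S ew'.
  by case/orP=> /eqP e1 /orP[]/eqP e2; subst; rewrite ?eqxx ?orbT // in ww' *.
case/orP: hp => [/eqP puv|/eqP pu].
  exists p; split=> // [x|]; first by rewrite in_setU1 negb_or => /andP[_ /fp].
  apply: covers_setU1 => // w w' wS w'S t'.
  have pvu : p v = u by rewrite -puv pK.
  by case/orP: (new w w' wS w'S t') => /andP[/eqP-> /eqP->];
    rewrite /cov ?puv ?pvu eqxx ?orbT.
have pe := fp _ eS; have qK := pswap_inv pK pe pu.
exists (pswap p e u); split=> // [x|].
  rewrite in_setU1 negb_or => /andP[xe xS]; rewrite /pswap (negPf xe) fp //.
  by case: eqP xS => // ->; rewrite uS.
apply: covers_setU1 => // [x y z xS yS zS t'|w w' wS w'S t'].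
  by apply: pswap_cov => //; apply: cp.
by case/orP: (new w w' wS w'S t') => /andP[/eqP-> /eqP->];
  rewrite /cov pswapL eqxx ?orbT.
Qed.

(** * Growing a set until it absorbs all triangles that meet it *)

Definition closed_in (U S : {set T}) :=
  forall x y z, x \in S -> y \in U -> z \in U -> tri x y z -> (y \in S) && (z \in S).

Lemma closed_inPn (U S : {set T}) : closed_in U S \/
  exists x y z, [/\ x \in S, y \in U, z \in U, y \notin S & tri x y z].
Proof.
case: (boolP [exists x, exists y, exists z,
    [&& x \in S, y \in U, z \in U, y \notin S & tri x y z]]).
  by case/existsP=> x /existsP[y /existsP[z /and5P[*]]]; right; exists x, y, z.
move=> none; left=> x y z xS yU zU t.
apply: contraR none; rewrite negb_and => h.
apply/existsP; exists x; apply/existsP.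
case/orP: h => h; [exists y|exists z]; apply/existsP; [exists z|exists y].
  by rewrite xS yU zU h t.
by rewrite xS yU zU h tri_swap23.
Qed.

Definition closable (U S : {set T}) := exists (S' : {set T}) (p : T -> T),
  [/\ S \subset S', S' \subset U, pairing p S' & closed_in U S'].

Definition diamond_free (U : {set T}) :=
  forall a b c d, [/\ a \in U, b \in U, c \in U & d \in U] -> c != d ->
    tri a b c -> tri a b d -> False.

(* [c] bounds twice the excess 10|S| - 7e(S), which drops by at least 1 with
   each triangle attached at a vertex and by at least 4 with each triangle
   attached along an edge; sparsity keeps it nonnegative. *)
Lemma closure_by_vertex_steps (U : {set T}) : sparse 23 ->
  forall c (S : {set T}) p, S \subset U -> pairing p S ->
  20 * #|S| <= 7 * narcs S + c -> #|S| + c <= 21 ->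
  (c < 8 \/ [/\ c <= 18, diamond_free U &
     forall x y, x \in S -> y \in S -> G x y -> exists2 z, z \in S & tri x y z]) ->
  closable U S.
Proof.
move=> sp; elim/ltn_ind=> c IH S p SU pS ex cS hc.
case: (closed_inPn U S) => [cl|]; first by exists S, p; split.
case=> v [a [b [vS aU bU aS t]]].
have vU := subsetP SU _ vS.
have c18 : c <= 18 by case: hc => [|[]] //; clear; lia.
have cS' : #|S| <= 21 by clear -cS; lia.
have [bS|bS] := boolP (b \in S).
  (* A triangle on an edge of [S] adds 4 arcs and one vertex, which costs 28 - 20 = 8 units of [c].
     In the second alternative that edge already lies in a triangle of [S], and the two triangles
     form a diamond. *)
  exfalso; have t' : tri v b a by apply: tri_swap23.
  have h := arcs_edge_step vS bS aS t'.
  have h' : 7 * narcs (a |: S) <= 20 * (1 + #|S|).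
    by have := sp (a |: S); rewrite cardsU1 aS; apply; clear -cS'; lia.
  case: hc => [c8|[_ df tin]]; first by clear -h h' ex c8; lia.
  have [z zS tz] : exists2 z, z \in S & tri v b z.
    by apply: tin => //; case/and3P: t'.
  apply: (df v b a z) => //; first by rewrite vU bU aU (subsetP SU).
  by apply: contraNneq aS => ->.
have ab : a != b by case/and3P: t => _ /adj_neq.
pose S' := a |: (b |: S).
have S'U : S' \subset U by rewrite !subUset !sub1set aU bU SU.
have cc : #|S'| = #|S| + 2 := card_vertex_step aS bS ab.
have sp' : 7 * narcs S' <= 20 * (#|S| + 2).
  by rewrite -cc; apply: sp; rewrite cc addn2 !ltnS.
have cnt : narcs S + 6 <= narcs S'.
  by have := arcs_vertex_step (D := [::]) vS aS bS t; rewrite addn0; apply.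
(* A triangle at a vertex costs 42 - 40 = 2 units of [c] while |S| grows by 2. So |S| + c <= 21
   persists, and sparsity is only applied to sets of at most 23 vertices. *)
have c2 : 2 <= c by clear -ex cnt sp'; lia.
have pS' : pairing (pswap p a b) S'.
  apply: (@pairing_vertex_step p v a b S c) => //.
  case: hc => [c8|[_ df _]]; first by left; clear -c8; lia.
  (* If [u] is adjacent to [v] and to [a], then [v a b] and [v a u] form a diamond; likewise for
     [b]. *)
  right=> u uS vu; have uU := subsetP SU _ uS.
  apply/andP; split; apply/negP=> gu.
    apply: (df v a b u) => //; first by apply: contraNneq bS => ->.
    by case/and3P: t => va _ _; rewrite /tri va gu vu.
  apply: (df v b a u) => //; first by apply: contraNneq aS => ->.
    exact: tri_swap23.
  by case/and3P: t => _ _ vb; rewrite /tri vb gu vu.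
have go c' : c' <= c - 2 -> 20 * #|S'| <= 7 * narcs S' + c' ->
    (c' < 8 \/ [/\ c' <= 18, diamond_free U &
     forall x y, x \in S' -> y \in S' -> G x y -> exists2 z, z \in S' & tri x y z]) ->
    closable U S.
  move=> c'c ex' hc'.
  have [] := IH c' _ S' (pswap p a b) S'U pS' ex' _ hc'.
  - by clear -c'c c2; lia.
  - by rewrite cc; clear -c'c cS c2; lia.
  move=> S2 [p2 [s1 s2 h1 h2]]; exists S2, p2; split=> //.
  by apply: subset_trans s1; rewrite /S' setUA subsetUr.
case: hc => [c8|[_ df tin]].
  apply: (go (c - 2)) => //; last by left; clear -c8; lia.
  by rewrite cc; clear -cnt ex c2; lia.
(* One further edge into [S] lowers [c] by 56 - 40 = 16 in all, to at most 2, and the first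
   alternative of the invariant takes over. *)
pose extra a' := [exists y, [&& y \in S, y != v & G a' y]].
have big a' b' : a' \notin S -> b' \notin S -> S' = a' |: (b' |: S) ->
    tri v a' b' -> extra a' -> 
    closable U S.
  move=> a'S b'S eS' t' /existsP[y /and3P[yS yv ga]].
  have : narcs S + 6 + 2 * size [:: y] <= narcs S'.
    rewrite eS'; apply: (@arcs_vertex_step v) => //; first by rewrite inE eq_sym.
    by move=> w; rewrite inE => /eqP->; rewrite yS.
  rewrite /= => cnt'; apply: (go (c - 16)); first by clear; lia.
    by rewrite cc; clear -cnt' ex sp'; lia.
  by left; clear -c18; lia.
have [ea|nea] := boolP (extra a); first exact: (big a b).
have [eb|neb] := boolP (extra b).
  by apply: (big b a) => //; [rewrite /S' setUCA | apply: tri_swap23].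
apply: (go (c - 2)) => //; first by rewrite cc; clear -cnt ex c2; lia.
(* Without further edges, every new edge belongs to the triangle [v a b], so the second alternative
   persists. *)
right; split=> //; first by clear -c18; lia.
have none a' y : ~~ extra a' -> y \in S -> G a' y -> y = v.
  move=> ne yS ga; apply/eqP; apply: contraR ne => yv.
  by apply/existsP; exists y; rewrite yS yv.
have vS' : v \in S' by rewrite !inE vS !orbT.
have aS' : a \in S' by rewrite !inE eqxx.
have bS' : b \in S' by rewrite !inE eqxx orbT.
have key a' b' y : ~~ extra a' -> tri v a' b' -> b' \in S' ->
    (y == b') || (y \in S) -> G a' y -> exists2 z, z \in S' & tri a' y z.
  move=> ne t' b'S' /orP[/eqP->|yS] gy.
    by exists v => //; apply: tri_rot.
  exists b' => //; rewrite (none _ _ ne yS gy); exact: tri_swap.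
have ta := tri_swap23 t.
have sw x y : (exists2 z, z \in S' & tri x y z) -> exists2 z, z \in S' & tri y x z.
  by case=> z zS tz; exists z => //; apply: tri_swap.
have hx x y : x \in S' -> y \in S' -> G x y -> x \notin S -> exists2 z, z \in S' & tri x y z.
  rewrite !in_setU1 => /or3P[/eqP->|/eqP->|-> //] hy gxy _.
    by apply: (key a b) => //; case/or3P: hy gxy => [/eqP->|->|->]; rewrite ?Girr ?orbT.
  by apply: (key b a) => //; case/or3P: hy gxy => [->|/eqP->|->]; rewrite ?Girr ?orbT.
move=> x y xS yS gxy.
have [xS0|] := boolP (x \in S); last exact: hx.
have [yS0|nyS] := boolP (y \in S).
  have [z zS tz] := tin x y xS0 yS0 gxy; exists z => //.
  by rewrite !inE zS !orbT.
by apply: sw; apply: hx => //; rewrite Gsym.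
Qed.

Lemma closable_sub (U S S' : {set T}) : S \subset S' -> closable U S' -> closable U S.
Proof.
move=> SS' [S2 [p [h1 h2 h3 h4]]]; exists S2, p; split=> //.
exact: subset_trans SS' h1.
Qed.

(** As [S] is independent, a triangle has at most one vertex in it and thus contains both [a] and
    [b]. *)
Lemma pairing_spine a b (S : {set T}) : {in S &, forall w w', ~~ G w w'} ->
  a \notin S -> b \notin S -> pairing (pswap id a b) (a |: (b |: S)).
Proof.
move=> ind aS bS; have qK : involutive (pswap id a b) by apply: pswap_inv.
split=> // [x|].
  by rewrite !in_setU1 !negb_or /pswap => /and3P[/negPf-> /negPf->].
have no x w w' : w \in S -> w' \in S -> tri x w w' -> False.
  by move=> wS w'S /and3P[_]; rewrite (negPf (ind _ _ wS w'S)).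
apply: covers_setU1 => //; first apply: covers_setU1 => //.
- by move=> x y z xS yS zS /(no _ _ _ yS zS).
- by move=> w w' wS w'S /(no _ _ _ wS w'S).
move=> w w'; rewrite !in_setU1.
case: (w =P b) => [-> _ _ _|_ /= wS]; first by rewrite /cov pswapL eqxx.
case: (w' =P b) => [-> _ _|_ /= w'S]; first by rewrite /cov pswapL eqxx !orbT.
by move/(no _ _ _ wS w'S).
Qed.

Lemma narcs_setU1 a (S : {set T}) (D : seq T) k : a \notin S -> uniq D ->
  {in D, forall y, (y \in S) && G a y} ->
  k <= narcs S -> k + 2 * size D <= narcs (a |: S).
Proof. by move=> aS uD hD kS; apply: leq_trans (arcs_setU1 aS uD hD); rewrite leq_add2r. Qed.

(** A triangle has 6 arcs, so c = 60 - 42 = 18 and |S| + c = 21, exactly what the growing procedure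
    allows. *)
Lemma closable_triangle (U : {set T}) x y z : sparse 23 -> diamond_free U ->
  x \in U -> y \in U -> z \in U -> tri x y z -> exists2 S : {set T}, x \in S & closable U S.
Proof.
move=> sp df xU yU zU t; have /and3P[xy yz xz] := t.
exists (x |: (y |: [set z])); first by rewrite !inE eqxx.
have yZ : y \notin [set z] by rewrite inE adj_neq.
have xYZ : x \notin y |: [set z] by rewrite !inE negb_or !adj_neq.
have cS : #|x |: (y |: [set z])| = 3 by rewrite !cardsU1 cards1 xYZ yZ.
have aS : 6 <= narcs (x |: (y |: [set z])).
  apply: (@narcs_setU1 x _ [:: y; z] 2) => //=; first by rewrite inE adj_neq.
    by move=> w; rewrite !inE => /orP[]/eqP->; rewrite eqxx ?orbT.
  apply: (@narcs_setU1 y _ [:: z] 0) => //= w.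
  by rewrite !inE => /eqP->; rewrite eqxx.
apply: (@closure_by_vertex_steps U sp 18 _ (pswap id x y)).
- by rewrite !subUset !sub1set xU yU zU.
- apply: pairing_spine => //; last by move: xYZ; rewrite !inE negb_or => /andP[].
  by move=> w w'; rewrite !inE => /eqP-> /eqP->; rewrite Girr.
- by rewrite cS; clear -aS; lia.
- by rewrite cS.
right; split=> // u v; rewrite !inE.
have e3 u' v' : tri u' v' x || tri u' v' y || tri u' v' z ->
    exists2 w, w \in x |: (y |: [set z]) & tri u' v' w.
  by case/orP=> [/orP[]|] h; [exists x|exists y|exists z]; rewrite // !inE eqxx ?orbT.
move=> /or3P[]/eqP-> /or3P[]/eqP->; rewrite ?Girr // => _; apply: e3.
- by rewrite t !orbT.
- by rewrite (tri_swap23 t) !orbT.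
- by rewrite (tri_swap t) !orbT.
- by rewrite (tri_rot t).
- by rewrite (tri_rot (tri_rot t)) !orbT.
by rewrite (tri_swap (tri_rot t)).
Qed.

Lemma pairing_edge_step_sym p u v e (S : {set T}) c :
  sparse 23 -> pairing p S -> u \in S -> v \in S -> e \notin S -> tri u v e ->
  20 * #|S| <= 7 * narcs S + c -> #|S| <= 22 -> c <= 18 ->
  [|| p u == v, p u == u | p v == v] -> exists q, pairing q (e |: S).
Proof.
move=> sp pS uS vS eS t ex cS c18; rewrite orbA => /orP[h|h].
  exact: (pairing_edge_step sp pS uS vS eS t ex cS c18).
have t' := tri_swap t.
by apply: (pairing_edge_step sp pS vS uS eS t' ex cS c18); rewrite h orbT.
Qed.

(** If [x] differed from [a], the edge [a y] would be a fourth new edge and 6 vertices would carry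
    at least 18 arcs, but 126 > 120. So x = a, and the diamonds on the edges [a b] and [a y] share
    only the vertex [a]. *)
Lemma diamond_step_DD a b c d x y z e (S : {set T}) :
  sparse 23 -> uniq [:: a; b; c; d] -> S = a |: (b |: [set c; d]) -> 10 <= narcs S ->
  x \in S -> y \notin S -> z \notin S -> e \notin S -> e != z ->
  tri a b c -> tri a b d -> tri x y z -> tri a y e ->
  is_DD a b c d y z e.
Proof.
move=> sp u4 eS nS xS yS zS eN ez tc td t te.
have yz : y != z by case/and3P: t => _ /adj_neq.
have ye : y != e by case/and3P: te => _ /adj_neq.
have cS : #|S| = 4.
  move: u4; rewrite /= !inE !negb_or -!andbA => /and5P[n1 n2 n3 n4 /and3P[n5 n6 _]].
  by rewrite eS !cardsU1 cards1 !inE !negb_or n1 n2 n3 n4 n5 n6.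
have aS : a \in S by rewrite eS !inE eqxx.
have xa : x = a.
  apply/eqP/negPn/negP => xa.
  have h1 : narcs S + 6 + 2 * size [:: a] <= narcs (y |: (z |: S)).
    apply: (@arcs_vertex_step x) => //; first by rewrite inE.
    by move=> w; rewrite inE => /eqP->; rewrite aS Gsym; case/and3P: te.
  have h2 : 7 * narcs (y |: (z |: S)) <= 20 * 6.
    by have := sp (y |: (z |: S)); rewrite card_vertex_step // cS; apply.
  by move: h1 h2 => /=; clear -nS; lia.
move: yS zS eN; rewrite eS !inE !negb_or => /and4P[ya yb yc yd].
move=> /and4P[za zb zc zd] /and4P[ea eb ec ed].
have u7 : uniq [:: a; b; c; d; y; z; e].
  move: u4 ya yb yc yd za zb zc zd ea eb ec ed yz ye ez.
  rewrite /= !inE !negb_or ![y == _]eq_sym ![z == _]eq_sym ![e == _]eq_sym.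
  move=> /and4P[/and3P[-> -> ->] /andP[-> ->] -> _].
  by do 15!move=> ->.
rewrite /is_DD u7; move: t tc td te; rewrite xa.
by move=> /and3P[-> -> ->] /and3P[-> -> ->] /and3P[_ -> ->] /and3P[_ -> ->].
Qed.

(** A diamond has c = 80 - 70 = 10, so at most two attached triangles bring c below 8, where the
    general procedure applies. A triangle at a vertex has its two new vertices paired; for a
    triangle on an edge, the only possible obstruction to extending the pairing yields a DD. *)
Lemma closable_diamond (U : {set T}) a b c d : sparse 23 ->
  (forall x1 x2 x3 x4 x5 x6 x7, all (mem U) [:: x1; x2; x3; x4; x5; x6; x7] ->
     ~~ is_DD x1 x2 x3 x4 x5 x6 x7) ->
  all (mem U) [:: a; b; c; d] -> c != d -> tri a b c -> tri a b d ->
  exists2 S : {set T}, a \in S & closable U S.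
Proof.
move=> sp noDD inU cd tc td.
have [aU bU cU dU] : [/\ a \in U, b \in U, c \in U & d \in U] by case/and5P: inU.
have /and3P[ab bc ac] := tc; have /and3P[_ bd ad] := td.
have u4 : uniq [:: a; b; c; d].
  by rewrite /= !inE !negb_or cd !adj_neq.
pose S := a |: (b |: [set c; d]).
have aS : a \in S by rewrite !inE eqxx.
exists S => //.
have bCD : b \notin [set c; d] by rewrite !inE negb_or !adj_neq.
have aCD : a \notin [set c; d] by rewrite !inE negb_or !adj_neq.
have aBCD : a \notin b |: [set c; d] by rewrite in_setU1 negb_or aCD adj_neq.
have cS : #|S| = 4 by rewrite cardsU1 aBCD cardsU1 bCD cards2 cd.
have bcd : narcs [set c; d] + 4 <= narcs (b |: [set c; d]).
  apply: (@narcs_setU1 b _ [:: c; d]) => //=; first by rewrite inE cd.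
  by move=> w; rewrite !inE => /orP[]/eqP->; rewrite eqxx ?orbT.
have nS0 : narcs [set c; d] + 10 <= narcs S.
  have : narcs [set c; d] + 4 + 2 * size [:: b; c; d] <= narcs S.
    apply: narcs_setU1 => //=; first by rewrite !inE negb_or cd !adj_neq.
    by move=> w; rewrite !inE => /or3P[]/eqP->; rewrite eqxx ?orbT.
  by rewrite /=; clear; lia.
have nS : 10 <= narcs S by clear -nS0; lia.
(* With the edge [c d] the four vertices would carry 12 arcs, but 84 > 80. So {c, d} is independent
   and pairing [a] with [b] covers the diamond. *)
have gcd : ~~ G c d.
  apply/negP=> gcd.
  have h1 : 2 <= narcs [set c; d].
    apply: (@narcs_setU1 c [set d] [:: d] 0) => //=; first by rewrite inE.
    by move=> w; rewrite !inE => /eqP->; rewrite eqxx.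
  have h2 : 7 * narcs S <= 20 * 4 by have := sp S; rewrite cS; apply.
  by clear -h1 h2 nS0; lia.
have pS : pairing (pswap id a b) S.
  apply: pairing_spine => // w w'; rewrite !inE.
  by move=> /orP[]/eqP-> /orP[]/eqP->; rewrite ?Girr // Gsym.
have SU : S \subset U by rewrite !subUset !sub1set aU bU cU dU.
have ex : 20 * #|S| <= 7 * narcs S + 10 by rewrite cS; clear -nS; lia.
case: (closed_inPn U S) => [cl|]; first by exists S, (pswap id a b); split.
case=> x [y [z [xS yU zU yS t]]].
have xU := subsetP SU _ xS.
have [zS|zS] := boolP (z \in S).
  have t' := tri_swap23 t.
  (* The pairing fixes [c] and [d] and matches [a] with [b], so every edge of [S] has a free end or
     is a pair. Afterwards c = 10 - 8 = 2. *)
  have [q qS] : exists q, pairing q (y |: S).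
    apply: (pairing_edge_step_sym sp pS xS zS yS t' ex); rewrite ?cS //.
    have xz : x != z by case/and3P: t => _ _ /adj_neq.
    rewrite /pswap.
    have [ea|xa] := eqVneq x a; have [eb|xb] := eqVneq x b; rewrite ?eqxx ?orbT //.
      have [ez|zb] := eqVneq z b; first by rewrite ?ez ?eqxx ?orbT.
      by have [ez|za] := eqVneq z a; rewrite ?eqxx ?orbT //; rewrite ea ez eqxx in xz.
    have [ez|za] := eqVneq z a; first by rewrite ?ez ?eqxx ?orbT.
    by have [ez|zb] := eqVneq z b; rewrite ?eqxx ?orbT //; rewrite eb ez eqxx in xz.
  have cq : #|y |: S| = 5 by rewrite cardsU1 yS cS.
  apply: (@closable_sub _ _ (y |: S)); first exact: subsetUr.
  have n' := arcs_edge_step xS zS yS t'.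
  apply: (@closure_by_vertex_steps U sp 2 _ q) => //; rewrite ?cq //.
  - by rewrite subUset sub1set yU.
  - by clear -n' nS; lia.
  by left.
have yz : y != z by case/and3P: t => _ /adj_neq.
pose S2 := y |: (z |: S); pose p2 := pswap (pswap id a b) y z.
have c2 : #|S2| = 6 by rewrite card_vertex_step // cS.
have S2U : S2 \subset U by rewrite 2!subUset !sub1set yU zU SU.
have SS2 : S \subset S2 by rewrite /S2 setUA subsetUr.
have pS2 : pairing p2 S2.
  by apply: (@pairing_vertex_step _ x y z S 10) => //; rewrite ?cS //; left.
have n2 : 16 <= narcs S2.
  have := arcs_vertex_step (D := [::]) xS yS zS t erefl erefl.
  by move=> h; apply: leq_trans (h _) => //=; clear -nS; lia.
have ex2 : 20 * #|S2| <= 7 * narcs S2 + 8 by rewrite c2; clear -n2; lia.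
apply: (closable_sub SS2).
case: (closed_inPn U S2) => [cl|]; first by exists S2, p2; split.
case=> x' [y' [z' [x'S y'U z'U y'S t']]].
have x'U := subsetP S2U _ x'S.
move: (y'S); rewrite in_setU1 negb_or => /andP[y'y].
rewrite in_setU1 negb_or => /andP[y'z y'S1].
have [z'S|z'S] := boolP (z' \in S2).
  have tt := tri_swap23 t'.
  (* Otherwise both ends are matched but not to each other: one is in {a, b}, the other in {y, z}.
     Then the new triangle and [x y z] form a diamond at [a] or [b], which completes the first
     diamond to a DD. *)
  have ok : [|| p2 x' == z', p2 x' == x' | p2 z' == z'].
    apply/negPn/negP; rewrite !negb_or => /and3P[h1 h2 h3].
    have x'z' : x' != z' by case/and3P: tt => /adj_neq.
    have inS w : w \in S -> (w == y) = false /\ (w == z) = false.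
      by move=> wS; split; apply/negbTE; [apply: contraNneq yS | apply: contraNneq zS] => <-.
    have moved w : p2 w != w -> [|| w == a, w == b, w == y | w == z].
      rewrite /p2 /pswap; case: (w == y); rewrite ?orbT //.
      by case: (w == z); rewrite ?orbT //; case: (w == a); case: (w == b); rewrite // eqxx.
    have tr := tri_swap23 t.
    have bS : b \in S by rewrite !inE eqxx orbT.
    have bac := tri_swap tc; have bad := tri_swap td.
    have u4' : uniq [:: b; a; c; d].
      by rewrite /= !inE !negb_or cd !adj_neq // Gsym.
    have eS' : S = b |: (a |: [set c; d]) by rewrite /S setUCA.
    have all7 u w e : u \in U -> w \in U -> e \in U -> all (mem U) [:: a; b; c; d; u; w; e].
      by move=> uU wU eU; rewrite /= aU bU cU dU uU wU eU.
    have all7' u w e : u \in U -> w \in U -> e \in U -> all (mem U) [:: b; a; c; d; u; w; e].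
      by move=> uU wU eU; rewrite /= aU bU cU dU uU wU eU.
    have bada e : e = a \/ e = b -> tri e y y' -> False.
      case=> -> te.
        have := diamond_step_DD sp u4 erefl nS xS yS zS y'S1 y'z tc td t te.
        by apply/negP; apply: noDD; apply: all7.
      have := diamond_step_DD sp u4' eS' nS xS yS zS y'S1 y'z bac bad t te.
      by apply/negP; apply: noDD; apply: all7'.
    have badz e : e = a \/ e = b -> tri e z y' -> False.
      case=> -> te.
        have := diamond_step_DD sp u4 erefl nS xS zS yS y'S1 y'y tc td tr te.
        by apply/negP; apply: noDD; apply: all7.
      have := diamond_step_DD sp u4' eS' nS xS zS yS y'S1 y'y bac bad tr te.
      by apply/negP; apply: noDD; apply: all7'.
    have [ay az] := inS _ aS; have [by_ bz] := inS _ bS.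
    have ts := tri_swap tt.
    have ba : (b == a) = false by rewrite eq_sym; apply/negbTE/adj_neq.
    have zy : (z == y) = false by rewrite eq_sym; apply/negbTE.
    case/or4P: (moved _ h2) => /eqP e1; case/or4P: (moved _ h3) => /eqP e2;
      rewrite e1 e2 ?eqxx // in x'z' h1 tt ts;
      rewrite /p2 /pswap ?ay ?az ?by_ ?bz ?ba ?zy ?eqxx // in h1.
    - exact: (bada a (or_introl erefl) tt).
    - exact: (badz a (or_introl erefl) tt).
    - exact: (bada b (or_intror erefl) tt).
    - exact: (badz b (or_intror erefl) tt).
    - exact: (bada a (or_introl erefl) ts).
    - exact: (bada b (or_intror erefl) ts).
    - exact: (badz a (or_introl erefl) ts).
    exact: (badz b (or_intror erefl) ts).
  have [q qS] : exists q, pairing q (y' |: S2).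
    by apply: (pairing_edge_step_sym sp pS2 x'S z'S y'S tt ex2); rewrite ?c2.
  have cq : #|y' |: S2| = 7 by rewrite cardsU1 y'S c2.
  apply: (@closable_sub _ _ (y' |: S2)); first exact: subsetUr.
  have n' := arcs_edge_step x'S z'S y'S tt.
  apply: (@closure_by_vertex_steps U sp 0 _ q) => //; rewrite ?cq //.
  - by rewrite subUset sub1set y'U.
  - by clear -n' n2; lia.
  by left.
have y'z' : y' != z' by case/and3P: t' => _ /adj_neq.
pose S3 := y' |: (z' |: S2).
have c3 : #|S3| = 8 by rewrite card_vertex_step // c2.
apply: (@closable_sub _ _ S3); first by rewrite /S3 setUA subsetUr.
apply: (@closure_by_vertex_steps U sp 6 _ (pswap p2 y' z')); rewrite ?c3 //.
- by rewrite 2!subUset !sub1set y'U z'U S2U.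
- by apply: (@pairing_vertex_step _ x' y' z' S2 8) => //; rewrite ?c2 //; left.
- have h : narcs S2 + 6 + 2 * size (Nil T) <= narcs S3.
    exact: (@arcs_vertex_step x').
  by move: h => /=; clear -n2; lia.
by left.
Qed.

(** Closed sets are split off one at a time. No triangle of [U] meets both a closed set and its
    complement, so the pairings of the two parts glue. *)
Lemma pairing_exists (U : {set T}) : sparse 23 ->
  (forall x1 x2 x3 x4 x5 x6 x7, all (mem U) [:: x1; x2; x3; x4; x5; x6; x7] ->
     ~~ is_DD x1 x2 x3 x4 x5 x6 x7) ->
  exists p, pairing p U.
Proof.
move=> sp; have [k] := ubnP #|U|; elim: k U => // k IH U; rewrite ltnS => cU noDD.
case: (boolP [exists x, exists y, exists z,
    [&& x \in U, y \in U, z \in U & tri x y z]]); last first.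
  move=> none; exists id; split=> // x y z xU yU zU t.
  case/negP: none; apply/existsP; exists x; apply/existsP; exists y.
  by apply/existsP; exists z; rewrite xU yU zU.
case/existsP=> x /existsP[y /existsP[z /and4P[xU yU zU t]]].
(* Start from a diamond if there is one; otherwise [U] is diamond free and the triangle serves. *)
have [x0 [S [p [x0S SU [pK fp cp] cl]]]] :
    exists x0 (S : {set T}) p, [/\ x0 \in S, S \subset U, pairing p S & closed_in U S].
  case: (boolP [exists a, exists b, exists c, exists d,
    [&& all (mem U) [:: a; b; c; d], c != d, tri a b c & tri a b d]]).
    case/existsP=> a /existsP[b /existsP[c /existsP[d /and4P[h1 h2 h3 h4]]]].
    have [S aS [S' [p [s1 s2 pS' cl]]]] := closable_diamond sp noDD h1 h2 h3 h4.
    by exists a, S', p; split=> //; apply: (subsetP s1).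
  move=> none; have df : diamond_free U.
    move=> a b c d [aU bU cU' dU] cd t1 t2; case/negP: none.
    apply/existsP; exists a; apply/existsP; exists b; apply/existsP; exists c.
    by apply/existsP; exists d; rewrite /= aU bU cU' dU cd t1 t2.
  have [S xS [S' [p [s1 s2 pS' cl]]]] := closable_triangle sp df xU yU zU t.
  by exists x, S', p; split=> //; apply: (subsetP s1).
have lt : #|U :\: S| < k.
  apply: leq_trans cU; apply: proper_card; apply/properP; split; first exact: subsetDl.
  by exists x0; [exact: (subsetP SU) | rewrite inE x0S].
have [|q [qK fq cq]] := IH _ lt.
  move=> x1 x2 x3 x4 x5 x6 x7 h; apply: noDD.
  by apply: sub_all h => w /=; rewrite inE => /andP[].
have pS w : (p w \in S) = (w \in S).
  have st v : v \in S -> p v \in S.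
    by move=> vS; apply/negPn/negP=> n; have := fp _ n; rewrite pK => e; rewrite -e vS in n.
  by apply/idP/idP => [/st|/st //]; rewrite pK.
have qS w : w \notin S -> q w \notin S.
  move=> wS; apply/negP=> qwS.
  have : q w \notin U :\: S by rewrite inE qwS.
  by move/fq; rewrite qK => e; rewrite -e (negPf wS) in qwS.
exists (fun w => if w \in S then p w else q w); split.
- move=> w; have [wS|wS] := boolP (w \in S); first by rewrite pS wS pK.
  by rewrite (negPf (qS _ wS)) qK.
- move=> w wU; have wS : w \notin S by apply: contra wU; apply: (subsetP SU).
  by rewrite (negPf wS) fq // inE (negPf wU) andbF.
move=> u v w uU vU wU t'; rewrite /cov.
have [uS|uS] := boolP (u \in S).
  have /andP[vS wS] := cl _ _ _ uS vU wU t'.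
  by rewrite vS; apply: cp.
have vS : v \notin S.
  by apply/negP=> vS; case/negP: uS; case/andP: (cl _ _ _ vS uU wU (tri_swap t')).
have wS : w \notin S.
  by apply/negP=> wS; case/negP: uS; case/andP: (cl _ _ _ wS uU vU (tri_rot (tri_rot t'))).
by rewrite (negPf vS); apply: cq => //; rewrite inE ?uS ?vS ?wS.
Qed.

End Pairings.

(** * The game *)

Lemma disjoint_setU1 (T : finType) (x : T) (A B : {set T}) :
  [disjoint x |: A & B] = (x \notin B) && [disjoint A & B].
Proof. by rewrite !disjoints_subset subUset sub1set inE. Qed.

Section Game.
Variables (n : nat) (G : rel 'I_n).
Implicit Types (M B : {set 'I_n}).

Lemma has_triangleI M x y z : x \in M -> y \in M -> z \in M ->
  G x y -> G y z -> G x z -> has_triangle G M.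
Proof.
move=> xM yM zM xy yz xz; apply/existsP; exists x; apply/existsP; exists y.
by apply/existsP; exists z; rewrite xM yM zM xy yz xz.
Qed.

Lemma has_triangleS M M' : M \subset M' -> has_triangle G M -> has_triangle G M'.
Proof.
move=> /subsetP s /existsP[x /existsP[y /existsP[z /and4P[xM yM zM /and3P[xy yz xz]]]]].
exact: (@has_triangleI _ x y z (s _ xM) (s _ yM) (s _ zM)).
Qed.

Lemma mb_win_maker f M B v : v \notin M -> v \notin B ->
  mb_win G f false (v |: M) B -> mb_win G f.+1 true M B.
Proof.
move=> vM vB w /=; case: ifP => [/negP[]|_].
  by apply/existsP; exists v; rewrite vM vB.
by apply/existsP; exists v; rewrite vM vB.
Qed.

Lemma mb_win_breaker f M B u : u \notin M -> u \notin B ->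
  (forall v, v \notin M -> v \notin B -> mb_win G f true M (v |: B)) ->
  mb_win G f.+1 false M B.
Proof.
move=> uM uB w /=; case: ifP => [/negP[]|_].
  by apply/existsP; exists u; rewrite uM uB.
by apply/forallP => v; apply/implyP=> /andP[]; apply: w.
Qed.

(** The game runs on until vertices or fuel are exhausted, but Maker's set only grows. *)
Lemma mb_win_triangle f b M B : has_triangle G M -> mb_win G f b M B.
Proof.
elim: f b M B => [|f IH] b M B t //=; case: ifP => // /negbT/negPn/existsP[v /andP[vM vB]].
case: b; last by apply/forallP=> w; apply/implyP=> _; apply: IH.
apply/existsP; exists v; rewrite vM vB /=; apply: IH.
by apply: has_triangleS t; apply: subsetUr.
Qed.

Lemma mb_win_two_threats f M B z1 z2 : z1 != z2 ->
  z1 \notin M -> z1 \notin B -> z2 \notin M -> z2 \notin B ->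
  has_triangle G (z1 |: M) -> has_triangle G (z2 |: M) ->
  mb_win G f.+2 false M B.
Proof.
move=> z12 z1M z1B z2M z2B t1 t2; apply: (@mb_win_breaker _ _ _ z1) => // v vM vB.
have [e|ne] := eqVneq v z1.
  apply: (@mb_win_maker _ _ _ z2) => //; last exact: mb_win_triangle.
  by rewrite in_setU1 negb_or z2B e eq_sym z12.
apply: (@mb_win_maker _ _ _ z1) => //; last exact: mb_win_triangle.
by rewrite in_setU1 negb_or z1B eq_sym ne.
Qed.

(** Maker claims [y] and threatens both [x y z1] and [x y z2]. *)
Lemma mb_win_diamond f M B x y z1 z2 : x \in M ->
  uniq [:: y; z1; z2] -> all (fun w => (w \notin M) && (w \notin B)) [:: y; z1; z2] ->
  G x y -> G x z1 -> G x z2 -> G y z1 -> G y z2 ->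
  mb_win G f.+3 true M B.
Proof.
move=> xM u al xy xz1 xz2 yz1' yz2'.
move: u; rewrite /uniq !inE !negb_or !andbT => /andP[/andP[yz1 yz2] z12].
case/and4P: al => /andP[yM yB] /andP[z1M z1B] /andP[z2M z2B] _.
apply: (@mb_win_maker _ _ _ y) => //.
apply: (@mb_win_two_threats _ _ _ z1 z2) => //; rewrite ?in_setU1 ?negb_or.
- by rewrite eq_sym yz1.
- by rewrite eq_sym yz2.
- by apply: (@has_triangleI _ x y z1); rewrite ?inE ?eqxx ?xM ?orbT.
by apply: (@has_triangleI _ x y z2); rewrite ?inE ?eqxx ?xM ?orbT.
Qed.

(** Maker claims the shared vertex [x]. Breaker's reply hits at most one of the two diamonds and
    Maker plays in the other, which makes five moves in all. *)
Lemma mb_win_DD f M B x y1 z1 z2 y2 z3 z4 : is_DD G x y1 z1 z2 y2 z3 z4 ->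
  all (fun w => (w \notin M) && (w \notin B)) [:: x; y1; z1; z2; y2; z3; z4] ->
  mb_win G f.+1.+4 true M B.
Proof.
rewrite /is_DD => /and5P[u xy1 xz1 xz2 /and5P[y1z1 y1z2 xy2 xz3 /and3P[xz4 y2z3 y2z4]]].
case/and5P=> /andP[xM xB] fy1 fz1 fz2 /and4P[fy2 fz3 fz4 _].
move: u; rewrite cons_uniq => /andP[xN u].
have /and3P[u1 dis u2] : [&& uniq [:: y1; z1; z2],
    ~~ has (mem [:: y1; z1; z2]) [:: y2; z3; z4] & uniq [:: y2; z3; z4]].
  by rewrite -cat_uniq.
apply: (@mb_win_maker _ _ _ x) => //.
(* [y1] only witnesses that a vertex is still free; Breaker's move is [v] below. *)
apply: (@mb_win_breaker _ _ _ y1).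
- rewrite in_setU1 negb_or; case/andP: fy1 => -> _; rewrite andbT.
  by move: xN; rewrite inE negb_or eq_sym => /andP[].
- by case/andP: fy1.
move=> v vM vB; have xM' : x \in x |: M by rewrite !inE eqxx.
have free w : w \in [:: y1; z1; z2; y2; z3; z4] -> (w \notin M) && (w \notin B) ->
    w != v -> (w \notin x |: M) && (w \notin v |: B).
  move=> wi /andP[wM wB] wv; rewrite !in_setU1 !negb_or wM wB wv !andbT.
  by apply: contraNneq xN => <-.
have [v1|v1] := boolP (v \in [:: y1; z1; z2]).
  have nv w : w \in [:: y2; z3; z4] -> w != v.
    by move=> wi; apply: contraNneq dis => e; apply/hasP; exists w; rewrite // e.
  apply: (@mb_win_diamond _ _ _ x y2 z3 z4) => //.
  by rewrite /all !free ?nv // !inE eqxx ?orbT.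
have nv w : w \in [:: y1; z1; z2] -> w != v by apply: contraTneq => ->.
apply: (@mb_win_diamond _ _ _ x y1 z1 z2) => //.
by rewrite /all !free ?nv // !inE eqxx ?orbT.
Qed.

(** Invariant: Breaker owns everything outside [U] and the partner of each matched vertex of Maker.
    Breaker answers [v] by [p v] if that is a free partner and by any vertex otherwise, since
    additional vertices never hurt. The last hypothesis says that the fuel suffices to fill the
    board. *)
Lemma breaker_pairing (p : 'I_n -> 'I_n) (U : {set 'I_n}) f M B :
  irreflexive G -> pairing G p U -> (forall x, x \notin U -> x \in B) ->
  [disjoint M & B] -> (forall x, x \in M -> p x != x -> p x \in B) ->
  n <= f + #|M| + #|B| -> ~~ mb_win G f true M B.
Proof.
move=> Girr [pK fp cp].
have [k] := ubnP f; elim: k f M B => // k IH f M B; rewrite ltnS => fk UB dMB inv cf.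
have notri M' B' : (forall x, x \notin U -> x \in B') -> [disjoint M' & B'] ->
    (forall x, x \in M' -> p x != x -> p x \in B') -> ~~ has_triangle G M'.
  move=> UB' d inv'; apply/negP=> /existsP[x /existsP[y /existsP[z]]].
  move=> /and4P[xM yM zM /and3P[xy yz xz]].
  have inU w : w \in M' -> w \in U.
    move=> wM; apply: contraT => /UB' wB.
    by have := disjointFr d wM; rewrite wB.
  have bad u v : u \in M' -> v \in M' -> G u v -> p u = v -> False.
    move=> uM vM uv e; have : p u \in B'.
      by apply: inv' => //; rewrite e eq_sym; apply: adj_neq uv.
    by rewrite e (disjointFr d vM).
  have t : tri G x y z by rewrite /tri xy yz xz.
  have /or3P[/eqP e|/eqP e|/eqP e] := cp x y z (inU _ xM) (inU _ yM) (inU _ zM) t.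
  - exact: (bad x y).
  - exact: (bad y z).
  exact: (bad x z).
have nt := notri M B UB dMB inv.
case: f fk cf => [|f] fk cf //=; case: ifP => // _.
apply/existsPn => v; apply/and3P => -[vM vB]; apply/negP.
have dvMB : [disjoint v |: M & B].
  by rewrite disjoint_setU1 vB dMB.
have UBw w x : x \notin U -> x \in w |: B by move/UB; rewrite inE orbC => ->.
have step w : w \notin M -> w \notin B -> w != v ->
    (p v != v -> p v \in w |: B) -> forall f', f' < k -> n <= f'.+2 + #|M| + #|B| ->
    ~~ mb_win G f' true (v |: M) (w |: B).
  move=> wM wB wv hv f' f'k cf'; apply: IH => //.
  - exact: UBw.
  - by rewrite disjoint_sym disjoint_setU1 in_setU1 negb_or wv wM disjoint_sym.
  - move=> x; rewrite in_setU1 => /predU1P[->|xM] // /(inv _ xM) h.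
    by rewrite inE h orbT.
  by rewrite !cardsU1 vM wB; clear -cf'; lia.
have [ok|nok] := boolP ((p v == v) || (p v \in B)).
  have inv' x : x \in v |: M -> p x != x -> p x \in B.
    rewrite in_setU1 => /predU1P[->|]; last exact: inv.
    by case/orP: ok => [->|].
  have nt' := notri _ B UB dvMB inv'.
  case: f fk cf => [|f] fk cf //=; case: ifP => // /negbT/negPn/existsP[w].
  rewrite in_setU1 negb_or -andbA => /and3P[wv wM wB].
  apply/forallPn; exists w; rewrite in_setU1 negb_or wv wM wB /=.
  apply: step => //; first by move=> h; rewrite inE inv' ?orbT ?inE ?eqxx.
  exact: ltnW.
move: nok; rewrite negb_or => /andP[pvv pvB].
have pvM : p v \notin M.
  apply: contra vB => pvM; have := inv _ pvM; rewrite pK; apply.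
  by rewrite eq_sym.
(* Both [v] and [p v] are free, so at least two moves remain and the fuel cannot run out before
   Breaker's reply. *)
have /subset_leq_card : v |: (p v |: (M :|: B)) \subset setT by apply: subsetT.
rewrite cardsT card_ord !cardsU1 !inE !negb_or [v == _]eq_sym pvv vM vB pvM pvB /=.
have -> : #|M :|: B| = #|M| + #|B| by rewrite cardsU (disjoint_setI0 dMB) cards0 subn0.
case: f fk cf => [|f] fk cf card2; first by exfalso; clear -cf card2; lia.
rewrite /=; case: ifP => [/existsPn/(_ (p v))|_].
  by rewrite in_setU1 negb_or pvv pvM pvB.
apply/forallPn; exists (p v); rewrite in_setU1 negb_or pvv pvM pvB /=.
by apply: step => //; [rewrite setU11 | exact: ltnW].
Qed.

End Game.

(** * Copies of the double diamond and the winner of the game *)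

Notation o7 i := (@Ordinal 7 i isT).

Lemma arcs_sum (T : finType) (F : rel T) (W : {set T}) :
  #|arcs F W| = \sum_(u : T) \sum_(v : T) [&& u \in W, v \in W & F u v].
Proof.
rewrite -sum1_card big_mkcond /= pair_bigA /=; apply: eq_bigr => -[u v] _.
by rewrite inE /=; case: ifP.
Qed.

Lemma card_sum (T : finType) (W : {set T}) : #|W| = \sum_(u : T) (u \in W).
Proof. by rewrite -sum1_card big_mkcond /=; apply: eq_bigr => u _; case: ifP. Qed.

(** DD is strictly balanced: a proper nonempty vertex set spans fewer than 10/7 edges per vertex.
    The sums are rewritten as a closed expression in seven booleans, which is evaluated in all 128
    cases. *)
Lemma DD_balanced (W : {set 'I_7}) :
  if #|W| == 7 then #|arcs DD W| == 20
  else (#|W| == 0) || (7 * #|arcs DD W| < 20 * #|W|).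
Proof.
rewrite arcs_sum card_sum.
have [w hw] : {w : nat -> bool | forall i : 'I_7, (i \in W) = w i}.
  by exists (fun k => inord k \in W) => i; rewrite inord_val.
have -> : \sum_(u : 'I_7) (u \in W) = sumn [seq nat_of_bool (w u) | u <- iota 0 7].
  under eq_bigr do rewrite hw.
  by rewrite sumnE big_map -(big_mkord xpredT (fun i => nat_of_bool (w i))) /index_iota.
pose D u v := ((u, v) \in DD_edges) || ((v, u) \in DD_edges).
have -> : \sum_(u : 'I_7) \sum_(v : 'I_7) [&& u \in W, v \in W & DD u v] =
    sumn [seq sumn [seq nat_of_bool [&& w u, w v & D u v] | v <- iota 0 7] | u <- iota 0 7].
  under eq_bigr do under eq_bigr do rewrite !hw.
  rewrite sumnE big_map -(big_mkord xpredT (fun i => \sum_(v < 7) [&& w i, w v & D i v])).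
  apply: eq_bigr => u _; rewrite sumnE big_map.
  by rewrite -(big_mkord xpredT (fun v => nat_of_bool [&& w u, w v & D u v])).
rewrite /=; move: (w 0) (w 1) (w 2) (w 3) (w 4) (w 5) (w 6).
by do 7!case.
Qed.

Lemma card_arcs_DD : #|arcs DD setT| = 20.
Proof. by apply/eqP; have := DD_balanced setT; rewrite cardsT card_ord. Qed.

Lemma DD_sym : symmetric DD. Proof. by move=> u v; rewrite /DD orbC. Qed.

Section Copies.
Variables (n : nat) (G : rel 'I_n).

Lemma embeds_inj f : embeds DD G f -> injective f.
Proof. by case/andP=> /injectiveP. Qed.

Lemma embeds_adj f u v : embeds DD G f -> DD u v -> G (f u) (f v).
Proof. by case/andP=> _ /forallP/(_ u)/forallP/(_ v)/implyP. Qed.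

Lemma embeds_is_DD f : embeds DD G f ->
  is_DD G (f (o7 0)) (f (o7 1)) (f (o7 2)) (f (o7 3)) (f (o7 4)) (f (o7 5)) (f (o7 6)).
Proof.
move=> ef; rewrite /is_DD !(embeds_adj ef) // !andbT.
by rewrite (map_inj_uniq (embeds_inj ef) [:: o7 0; o7 1; o7 2; o7 3; o7 4; o7 5; o7 6]).
Qed.

Lemma is_DD_embeds x0 x1 x2 x3 x4 x5 x6 : symmetric G ->
  is_DD G x0 x1 x2 x3 x4 x5 x6 ->
  exists2 f, embeds DD G f & forall i, f i \in [:: x0; x1; x2; x3; x4; x5; x6].
Proof.
move=> Gsym; rewrite /is_DD => /and5P[un e1 e2 e3 /and5P[e4 e5 e6 e7 /and3P[e8 e9 e10]]].
pose s := [:: x0; x1; x2; x3; x4; x5; x6].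
exists [ffun i : 'I_7 => nth x0 s i]; last first.
  by move=> i; rewrite ffunE; apply: mem_nth.
apply/andP; split.
  apply/injectiveP => i j; rewrite !ffunE => /eqP.
  by rewrite nth_uniq // => /eqP/val_inj.
apply/forallP => u; apply/forallP => v; apply/implyP; rewrite !ffunE /DD /=.
case: u v => [u /= _] [v /= _]; rewrite !inE !xpair_eqE.
by case/orP; do ![case/orP]; case/andP=> /eqP-> /eqP-> //=; rewrite Gsym.
Qed.

Lemma copy_ofE (f : {ffun 'I_7 -> 'I_n}) :
  copy_of DD f = [set (f e.1, f e.2) | e in arcs DD setT].
Proof.
apply/setP=> e; rewrite inE; apply/existsP/imsetP => [[u /existsP[v /andP[duv /eqP->]]]|].
  by exists (u, v); rewrite // !inE.
case=> -[u v]; rewrite !inE /= => duv ->; exists u; apply/existsP; exists v.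
by rewrite duv eqxx.
Qed.

Lemma card_copy (f : {ffun 'I_7 -> 'I_n}) : injective f -> #|copy_of DD f| = 20.
Proof.
move=> fI; rewrite copy_ofE card_imset ?card_arcs_DD // => -[u v] [u' v'] /= [].
by move=> /fI-> /fI->.
Qed.

(** A common arc, pulled back along [g], is an arc of DD between vertices that [g] sends into the
    image of [f]. *)
Lemma card_copyI (f g : {ffun 'I_7 -> 'I_n}) :
  #|copy_of DD f :&: copy_of DD g| <= #|arcs DD [set i | g i \in codom f]|.
Proof.
pose h (e : 'I_7 * 'I_7) := (g e.1, g e.2).
apply: leq_trans (leq_imset_card h _); apply: subset_leq_card.
apply/subsetP => e; rewrite inE !copy_ofE => /andP[/imsetP[[u v] _ ->]].
case/imsetP=> -[u' v']; rewrite !inE /= => d [eu ev]; apply/imsetP.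
by exists (u', v'); rewrite /h /= ?eu ?ev // !inE /= -eu -ev !codom_f.
Qed.

(** With |W| common vertices, the union has 14 - |W| vertices and at least 40 minus the number of
    arcs inside [W]. For 0 < |W| < 7 strict balance makes this too many for a sparse graph; for |W|
    = 7 there is room for 20 arcs only, so the copies coincide. *)
Lemma copies_disjoint f g : sparse G 23 -> embeds DD G f -> embeds DD G g ->
  copy_of DD f != copy_of DD g -> forall i, g i \notin codom f.
Proof.
move=> sp ef eg ne; have fI := embeds_inj ef; have gI := embeds_inj eg.
pose W := [set i | g i \in codom f].
suff W0 : #|W| = 0.
  move=> i; move/eqP: W0; rewrite cards_eq0 => /eqP/setP/(_ i).
  by rewrite !inE => ->.
pose A := [set f i | i in 'I_7]; pose B := [set g i | i in 'I_7].
have cA : #|A| = 7 by rewrite card_imset // card_ord.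
have cB : #|B| = 7 by rewrite card_imset // card_ord.
have cI : #|A :&: B| = #|W|.
  rewrite -(card_imset _ gI); apply: eq_card => x; rewrite inE; apply/andP/imsetP.
    case=> /imsetP[i _ ->] /imsetP[j _ e]; exists j => //.
    by rewrite inE -e codom_f.
  by case=> j; rewrite inE => /codomP[i e] ->; split; [rewrite e|]; apply: imset_f.
have cW : #|W| <= 7 by rewrite -cI -cA subset_leq_card ?subsetIl.
have cU : #|A :|: B| = 14 - #|W| by rewrite cardsU cA cB cI.
have sub : copy_of DD f :|: copy_of DD g \subset arcs G (A :|: B).
  apply/subsetP=> e; rewrite !inE => /orP[] /existsP[u /existsP[v /andP[d /eqP->]]] /=.
    by rewrite !imset_f // (embeds_adj ef).
  by rewrite !(imset_f g) // !orbT (embeds_adj eg).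
have h1 : 40 - #|copy_of DD f :&: copy_of DD g| <= narcs G (A :|: B).
  by apply: leq_trans (subset_leq_card sub); rewrite cardsU !card_copy.
have h2 : 7 * narcs G (A :|: B) <= 20 * (14 - #|W|).
  by rewrite -cU; apply: sp; rewrite cU; clear; lia.
have h3 : #|copy_of DD f :&: copy_of DD g| <= #|arcs DD W| := card_copyI f g.
have := DD_balanced W; case: ifP => [/eqP W7 _|_ /orP[/eqP //|h4]]; last first.
  exfalso; move: h1 h2 h3 h4 cW; clear.
  by move: #|_ :&: _| (narcs _ _) #|arcs _ _| #|W| => a b c d; lia.
exfalso; case/eqP: ne.
have cO : #|copy_of DD f :|: copy_of DD g| <= 20.
  have h5 : narcs G (A :|: B) <= 20 by move: h2; rewrite W7; clear; lia.
  exact: leq_trans (subset_leq_card sub) h5.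
have e1 : copy_of DD f = copy_of DD f :|: copy_of DD g.
  by apply/eqP; rewrite eqEcard subsetUl card_copy.
have e2 : copy_of DD g = copy_of DD f :|: copy_of DD g.
  by apply/eqP; rewrite eqEcard subsetUr card_copy.
by rewrite e1 -e2.
Qed.

Lemma contains_1P : reflect (exists f, embeds DD G f) (contains_k DD 1 G).
Proof.
apply: (iffP existsP) => [[fs /andP[/forallP e _]]|[f ef]]; first by exists (fs ord0).
exists [ffun=> f]; apply/andP; split; first by apply/forallP => i; rewrite ffunE.
by apply/forallP => i; apply/forallP => j; rewrite !ord1.
Qed.

Lemma contains_2P :
  reflect (exists f g, [/\ embeds DD G f, embeds DD G g & copy_of DD f != copy_of DD g])
    (contains_k DD 2 G).
Proof.
apply: (iffP existsP) => [[fs /andP[/forallP e /forallP d]]|[f [g [ef eg ne]]]].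
  exists (fs ord0), (fs ord_max); split=> //.
  by move/forallP: (d ord0) => /(_ ord_max).
exists [ffun i : 'I_2 => if i == ord0 then f else g]; apply/andP; split.
  by apply/forallP => i; rewrite ffunE; case: ifP.
apply/forallP => i; apply/forallP => j; apply/implyP; rewrite !ffunE.
case: i j => [[|[|//]] i] [[|[|//]] j] //= _.
by rewrite eq_sym.
Qed.

Lemma embeds_card f : embeds DD G f -> 7 <= n.
Proof. by move/embeds_inj/leq_card; rewrite !card_ord. Qed.

Lemma mb_win_embeds f (h : {ffun 'I_7 -> 'I_n}) (M B : {set 'I_n}) : embeds DD G h -> 5 <= f ->
  (forall i, (h i \notin M) && (h i \notin B)) -> mb_win G f true M B.
Proof.
case: f => [|[|[|[|[|f]]]]] // eh _ fr.
by apply: (mb_win_DD _ (embeds_is_DD eh)); rewrite /all !fr.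
Qed.

Lemma Maker1_of_DD : contains_k DD 1 G -> Maker1 G.
Proof.
case/contains_1P=> f ef; apply: (mb_win_embeds ef); last by move=> i; rewrite !inE.
exact: leq_trans (embeds_card ef).
Qed.

(** Whatever vertex Breaker claims first, one of the two copies stays untouched. *)
Lemma Maker2_of_disjoint_DD f g : embeds DD G f -> embeds DD G g ->
  (forall i, g i \notin codom f) -> Maker2 G.
Proof.
move=> ef eg dis; suff win m : 7 <= m -> mb_win G m false set0 set0.
  exact: win (embeds_card ef).
case: m => // m; rewrite ltnS => m6.
apply: (@mb_win_breaker _ _ _ _ _ (f ord0)); rewrite ?inE // => v _ _.
have [vf|vf] := boolP (v \in codom f).
  apply: (mb_win_embeds eg); first exact: ltnW.
  by move=> i; rewrite !inE orbF /=; apply: contraNneq (dis i) => ->.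
apply: (mb_win_embeds ef); first exact: ltnW.
by move=> i; rewrite !inE orbF /=; apply: contraNneq vf => <-; apply: codom_f.
Qed.

Hypotheses (Gsym : symmetric G) (Girr : irreflexive G) (Gsp : sparse G 23).

Lemma Maker1E : Maker1 G = contains_k DD 1 G.
Proof.
apply/idP/idP; last exact: Maker1_of_DD.
apply: contraTT => noDD.
have [|p pT] := @pairing_exists _ G Gsym Girr setT Gsp.
  move=> x1 x2 x3 x4 x5 x6 x7 _; apply/negP => /(is_DD_embeds Gsym)[f ef _].
  by case/negP: noDD; apply/contains_1P; exists f.
apply: (breaker_pairing Girr pT); rewrite ?cards0 ?addn0 //.
- by move=> x; rewrite inE.
- by rewrite disjoints_subset sub0set.
by move=> x; rewrite inE.
Qed.

(** Without two distinct copies, some vertex [w] lies in every copy. Breaker claims [w] first and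
    then follows a pairing of the other vertices, which span no DD. *)
Lemma Maker2E : 0 < n -> Maker2 G = contains_k DD 2 G.
Proof.
move=> n0; apply/idP/idP; last first.
  case/contains_2P=> f [g [ef eg ne]].
  exact: (Maker2_of_disjoint_DD ef eg (copies_disjoint Gsp ef eg ne)).
apply: contraTT => no2.
have [w hw] : exists w, forall f, embeds DD G f -> w \in codom f.
  case: (boolP (contains_k DD 1 G)) => [/contains_1P[f ef]|no1]; last first.
    exists (Ordinal n0) => f ef; case/negP: no1; apply/contains_1P; by exists f.
  (* Every embedding has the same copy as [f], so its image contains this end of the arc from [f 0]
     to [f 1]. *)
  exists (f (o7 0)) => g eg.
  have e : copy_of DD f = copy_of DD g.
    by apply/eqP; apply: contraR no2 => ne; apply/contains_2P; exists f, g.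
  have : (f (o7 0), f (o7 1)) \in copy_of DD f.
    by rewrite inE; apply/existsP; exists (o7 0); apply/existsP; exists (o7 1); rewrite eqxx.
  by rewrite e inE => /existsP[u /existsP[v /andP[_ /eqP[-> _]]]]; apply: codom_f.
have [|p pU] := @pairing_exists _ G Gsym Girr (~: [set w]) Gsp.
  move=> x1 x2 x3 x4 x5 x6 x7 inU; apply/negP => /(is_DD_embeds Gsym)[f ef fi].
  have /codomP[i e] := hw f ef; have := allP inU _ (fi i).
  by rewrite -e !inE eqxx.
suff lose m : 0 < m -> n <= m -> ~~ mb_win G m false set0 set0 by apply: lose.
case: m => //= m _ nm; case: ifP => [/existsPn/(_ w)|_]; first by rewrite !inE.
apply/forallPn; exists w; rewrite !inE /=.
apply: (breaker_pairing Girr pU); rewrite ?cards0.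
- by move=> x; rewrite !inE negbK orbF.
- by rewrite disjoints_subset sub0set.
- by move=> x; rewrite inE.
by rewrite cardsU1 inE cards0 addn0 addn0 addn1.
Qed.

End Copies.

(** * Edge indices and random permutations *)

Lemma mem_Kedges n i j : ((i, j) \in Kedges n) = (i < j < n).
Proof.
apply/allpairsPdep/idP => [[i' [j' []]]|/andP[ij jn]].
  by rewrite mem_iota mem_filter mem_iota /= add0n => i'n /andP[ij jn] [-> ->]; rewrite ij.
exists i, j; rewrite mem_iota mem_filter mem_iota /= add0n ij jn.
by rewrite (ltn_trans ij).
Qed.

Lemma Kedges_uniq n : uniq (Kedges n).
Proof.
apply: allpairs_uniq_dep => [|i _|[i j] [i' j'] _ _ /= [-> ->] //].
  exact: iota_uniq.
by rewrite filter_uniq // iota_uniq.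
Qed.

Section EdgeIndex.
Variables (n : nat) (k0 : 'I_(nedges n)).

Definition sorted_pair (x y : 'I_n) : nat * nat :=
  if x < y then (val x, val y) else (val y, val x).

(** [k0] is a default value, taken when x = y. *)
Definition eix (x y : 'I_n) : 'I_(nedges n) :=
  insubd k0 (index (sorted_pair x y) (Kedges n)).

Lemma sorted_pair_Kedges x y : x != y -> sorted_pair x y \in Kedges n.
Proof.
rewrite /sorted_pair -val_eqE /= => ne; case: ltnP => h; rewrite mem_Kedges.
  by rewrite h ltn_ord.
by rewrite ltn_neqAle eq_sym ne h ltn_ord.
Qed.

Lemma val_eix x y : x != y -> val (eix x y) = index (sorted_pair x y) (Kedges n).
Proof. by move=> ne; rewrite val_insubd /nedges index_mem sorted_pair_Kedges. Qed.

Lemma nth_eix x y : x != y -> nth (0, 0) (Kedges n) (eix x y) = sorted_pair x y.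
Proof. by move=> ne; rewrite val_eix // nth_index // sorted_pair_Kedges. Qed.

Lemma eixC x y : eix x y = eix y x.
Proof.
rewrite /eix /sorted_pair; case: (ltngtP x y) => // /val_inj ->.
by [].
Qed.

Lemma eix_lt_inj (x y x' y' : 'I_n) : x < y -> x' < y' -> eix x y = eix x' y' -> x = x' /\ y = y'.
Proof.
move=> xy x'y' e.
have n1 : x != y by rewrite -val_eqE /= neq_ltn xy.
have n2 : x' != y' by rewrite -val_eqE /= neq_ltn x'y'.
have := nth_eix n1; rewrite e nth_eix // /sorted_pair xy x'y' => -[ex ey].
by split; apply: val_inj.
Qed.

Lemma eix_inj (x y x' y' : 'I_n) : x != y -> x' != y' -> eix x y = eix x' y' ->
  (x, y) = (x', y') \/ (x, y) = (y', x').
Proof.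
move=> ne ne' e; have := nth_eix ne; rewrite e nth_eix // /sorted_pair.
by case: ifP => _; case: ifP => _ [] /val_inj-> /val_inj->; [left|right|right|left].
Qed.

Lemma GprocE (s : {perm 'I_(nedges n)}) i x y :
  Gproc s i x y = (x != y) && (s (eix x y) < i).
Proof.
apply/existsP/andP => [[k /andP[ki h]]|[ne h]]; last first.
  exists (eix x y); rewrite h nth_eix // /sorted_pair.
  by case: ifP; rewrite eqxx ?orbT.
have mk : nth (0, 0) (Kedges n) k \in Kedges n by apply: mem_nth.
have ne : x != y.
  apply: contraTneq mk => e; case/orP: h => /eqP->;
  by rewrite e mem_Kedges ltnn.
split=> //; suff -> : eix x y = k by [].
apply: val_inj; rewrite val_eix // -[RHS](index_uniq (0, 0) (ltn_ord k) (Kedges_uniq n)).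
congr index; rewrite /sorted_pair.
case/orP: h => /eqP e; move: mk; rewrite e mem_Kedges => /andP[lt _].
  by rewrite lt.
by rewrite ltnNge (ltnW lt).
Qed.

Lemma Gproc_sym (s : {perm 'I_(nedges n)}) i : symmetric (Gproc s i).
Proof. by move=> x y; rewrite !GprocE eq_sym eixC. Qed.

Lemma Gproc_irr (s : {perm 'I_(nedges n)}) i : irreflexive (Gproc s i).
Proof. by move=> x; rewrite GprocE eqxx. Qed.

Definition eixp (e : 'I_n * 'I_n) := eix e.1 e.2.

(** Each edge index in the image comes from two arcs, one increasing and its reversal. *)
Lemma card_eix (C : {set 'I_n * 'I_n}) :
  (forall x y, (x, y) \in C -> (x != y) && ((y, x) \in C)) -> #|C| = 2 * #|eixp @: C|.
Proof.
move=> hC; pose L := [set e : 'I_n * 'I_n in C | e.1 < e.2].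
have cL : #|eixp @: C| = #|L|.
  rewrite -(card_in_imset (f := eixp) (D := mem L)); last first.
    move=> [x y] [x' y']; rewrite !inE /= => /andP[_ xy] /andP[_ xy'] /(eix_lt_inj xy xy')[-> ->].
    by [].
  apply: eq_card => k; apply/imsetP/imsetP => [[[x y] xyC ->]|[e]]; last first.
    by rewrite inE => /andP[eC _] ->; exists e.
  have /andP[ne yxC] := hC _ _ xyC.
  have [lt|ge] := ltnP x y; first by exists (x, y); rewrite // inE xyC.
  exists (y, x); rewrite /eixp /= 1?eixC // inE yxC /= ltn_neqAle ge andbT.
  by rewrite eq_sym.
rewrite cL mul2n -addnn -(cardsID L C); congr (_ + _).
  by apply: eq_card => e; rewrite !inE; case: (e \in C); rewrite ?andbF.
pose sw (e : 'I_n * 'I_n) := (e.2, e.1).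
have swI : injective sw by move=> [x y] [x' y'] [-> ->].
rewrite -(card_imset (mem L) swI); apply: eq_card => -[x y]; rewrite inE.
apply/andP/imsetP => [[xyL xyC]|[[x' y']]]; last first.
  rewrite inE /= => /andP[yxC lt] [-> ->]; have /andP[_ xyC] := hC _ _ yxC.
  by rewrite xyC inE /= xyC /= -leqNgt ltnW.
have /andP[ne yxC] := hC _ _ xyC; exists (y, x) => //.
move: xyL; rewrite !inE xyC yxC /= -leqNgt => le.
by rewrite ltn_neqAle le andbT eq_sym.
Qed.

Lemma card_ord_neq : #|[set e : 'I_n * 'I_n | e.1 != e.2]| = n * n.-1.
Proof.
have -> : [set e : 'I_n * 'I_n | e.1 != e.2] = ~: [set (x, x) | x : 'I_n].
  apply/setP=> -[x y]; rewrite !inE /=; congr (~~ _); apply/eqP/imsetP.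
    by move=> ->; exists y.
  by case=> z _ [-> ->].
have := cardsC [set (x, x) | x : 'I_n].
rewrite card_imset; last by move=> x y [].
rewrite card_prod !card_ord -subn1 mulnBr muln1 => h.
by rewrite -[X in X - _]h addKn.
Qed.

Lemma nedgesE : 2 * nedges n = n * n.-1.
Proof.
rewrite -card_ord_neq (card_eix (C := [set e | e.1 != e.2])); last first.
  by move=> x y; rewrite !inE /= => h; rewrite h eq_sym.
congr (2 * _); rewrite -[LHS]card_ord -cardsT; apply: eq_card => k; rewrite inE; apply/esym.
apply/imsetP.
have : nth (0, 0) (Kedges n) k \in Kedges n by apply: mem_nth.
case E : (nth _ _ _) => [i j]; rewrite mem_Kedges => /andP[ij jn].
pose x := Ordinal (ltn_trans ij jn); pose y := Ordinal jn.
have xy : x != y by rewrite -val_eqE /= neq_ltn ij.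
exists (x, y); rewrite ?inE // /eixp /=; apply: val_inj; rewrite val_eix //.
rewrite -[LHS](index_uniq (0, 0) (ltn_ord k) (Kedges_uniq n)) E.
by congr index; rewrite /sorted_pair /= ij.
Qed.

End EdgeIndex.

(** * The probability that given edges are among the first [m] *)

Section PermCount.
Variables (N m : nat).
Hypothesis mN : m <= N.
Implicit Types (s : {perm 'I_N}) (A : {set 'I_N}).

(** For the process, these are the indices of the edges of G_m. *)
Definition early s : {set 'I_N} := [set k | s k < m].

Lemma card_early s : #|early s| = m.
Proof.
rewrite -(card_imset _ (@perm_inj _ s)).
have -> : [set s k | k in early s] = [set k : 'I_N | k < m].
  apply/setP=> k; rewrite inE; apply/imsetP/idP => [[j]|km].
    by rewrite inE => h ->.
  by exists (s^-1 k)%g; rewrite ?inE permKV.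
rewrite -sum1_card; under eq_bigl do rewrite inE.
by rewrite (big_ord_narrow mN) sum1_card card_ord.
Qed.

Definition count_early A := #|[set s : {perm 'I_N} | A \subset early s]|.

(** Composing with the transposition of [a] and [b] is a bijection that exchanges the two events. *)
Lemma count_early_swap A a b : a \notin A -> b \notin A ->
  count_early (a |: A) = count_early (b |: A).
Proof.
move=> aA bA; rewrite /count_early.
have tI : injective (fun s : {perm 'I_N} => (tperm a b * s)%g) by apply: mulgI.
rewrite -(card_imset _ tI); apply: eq_card => s; rewrite inE.
have sub s' c : (c |: A \subset early s') = (s' c < m) && (A \subset early s').
  by rewrite subUset sub1set inE.
have eA s' : (A \subset early (tperm a b * s')%g) = (A \subset early s').
  apply/subsetP/subsetP => h x xA; move: (h x xA); rewrite !inE permM;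
  rewrite tpermD //; by [apply: contraNneq aA => -> | apply: contraNneq bA => ->].
apply/imsetP/idP => [[s']|].
  by rewrite inE sub => /andP[h1 h2] ->; rewrite sub permM tpermR h1 eA.
rewrite sub => /andP[h1 h2]; exists (tperm a b * s)%g.
  by rewrite inE sub permM tpermL h1 eA.
by rewrite mulgA tperm2 mul1g.
Qed.

(** Double count the permutations with [A] early together with one more early element [b] outside
    [A]: by symmetry all N - |A| choices of [b] contribute equally, and each permutation has m - |A|
    such elements. *)
Lemma count_early_rec A a : a \notin A ->
  (N - #|A|) * count_early (a |: A) = (m - #|A|) * count_early A.
Proof.
move=> aA.
have -> : (N - #|A|) * count_early (a |: A) = \sum_(b in ~: A) count_early (b |: A).
  rewrite (eq_bigr (fun=> count_early (a |: A))); last first.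
    by move=> b; rewrite inE => bA; apply: count_early_swap.
  by rewrite sum_nat_const; congr (_ * _); rewrite -(addKn #|A| #|~: A|) cardsC card_ord.
transitivity (\sum_(s in [set s | A \subset early s]) \sum_(b in ~: A) (b \in early s)).
  rewrite exchange_big /=; apply: eq_bigr => b _.
  rewrite /count_early -sum1_card big_mkcond [RHS]big_mkcond /=; apply: eq_bigr => s _.
  by rewrite !inE subUset sub1set inE andbC; case: (A \subset _) => //=; case: ifP.
rewrite mulnC /count_early -sum_nat_const; apply: eq_bigr => s; rewrite inE => As.
rewrite -(card_early s) -(cardsID A (early s)) (setIidPr As) addKn -sum1_card.
rewrite big_mkcond [RHS]big_mkcond /=; apply: eq_bigr => b _.
by rewrite !inE; case: (b \in A) => //=; case: (_ < m).
Qed.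

(** Cross-multiplied form of the probability m^_k / N^_k, with k = |A|, that all of [A] is early. *)
Lemma count_earlyE A : count_early A * N ^_ #|A| = N`! * m ^_ #|A|.
Proof.
have [k] := ubnP #|A|; elim: k A => // k IH A; rewrite ltnS => Ak.
have [->|[a aA]] := set_0Vmem A.
  rewrite cards0 !ffactn0 !muln1 /count_early -card_Sn; apply: eq_card => s.
  by rewrite !inE sub0set.
rewrite (cardsD1 a) aA add1n !ffactnSr -[A in count_early A](setD1K aA).
set A' := A :\ a; have A'k : #|A'| < k by apply: leq_trans Ak; rewrite (cardsD1 a A) aA.
have aA' : a \notin A' by rewrite !inE eqxx.
rewrite [_ ^_ _ * (N - _)]mulnC mulnA [count_early _ * _]mulnC count_early_rec //.
by rewrite -mulnA IH // mulnC mulnA.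
Qed.

End PermCount.

(** * Probability estimates *)

Lemma ffact_le_exp (m k : nat) : m ^_ k <= m ^ k.
Proof. by elim: k => // k IH; rewrite ffactnSr expnSr leq_mul // leq_subr. Qed.

Lemma leq_exp2 (a b k : nat) : a <= b -> a ^ k <= b ^ k.
Proof. by case: k => // k; rewrite leq_exp2r. Qed.

Lemma bin_le_exp (n k : nat) : 'C(n, k) <= n ^ k.
Proof.
apply: leq_trans (ffact_le_exp n k); rewrite -bin_ffact.
by rewrite leq_pmulr // fact_gt0.
Qed.

(** Factor by factor, (m - i) / (N - i) <= m / N, in cross-multiplied form. *)
Lemma ffact_exp_cross (m N k : nat) : m <= N -> m ^_ k * N ^ k <= m ^ k * N ^_ k.
Proof.
move=> mN; elim: k => // k IH; rewrite !ffactnSr !expnSr.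
rewrite mulnACA [X in _ <= X]mulnACA; apply: leq_mul => //.
by rewrite mulnBl mulnBr [m * N]mulnC leq_sub2l // mulnC leq_mul2l mN orbT.
Qed.

(** Knowing that [j] edges are early makes further ones less likely: the shift by [j] lowers each
    ratio (m - i) / (N - i). *)
Lemma ffact_double_cross (m N j k : nat) : m <= N ->
  (m - j) ^_ k * N ^_ k <= (N - j) ^_ k * m ^_ k.
Proof.
move=> mN; elim: k => // k IH; rewrite !ffactnSr.
rewrite mulnACA [X in _ <= X]mulnACA; apply: leq_mul => //.
have [le|lt] := leqP m (j + k); first by rewrite -subnDA (eqP (_ : m - (j + k) == 0)) ?subn_eq0.
by clear -mN lt; nia.
Qed.

Lemma ffactD (m a b : nat) : m ^_ (a + b) = m ^_ a * (m - a) ^_ b.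
Proof.
by elim: b => [|b IH]; rewrite ?addn0 ?ffactn0 ?muln1 // addnS !ffactnSr IH mulnA subnDA.
Qed.

Lemma exp_le_ffact (m k : nat) : 2 * k <= m -> m ^ k <= 2 ^ k * m ^_ k.
Proof.
elim: k => // k IH h; rewrite !expnSr ffactnSr mulnACA; apply: leq_mul.
  by apply: IH; clear -h; lia.
by clear -h; lia.
Qed.

Section Probability.
Local Open Scope ring_scope.
Variables (n : nat) (k0 : 'I_(nedges n)) (m : nat).
Local Notation N := (nedges n).
Local Notation perms := {perm 'I_N}.
Hypothesis mN : (m <= N)%N.

Definition pr (E : pred perms) : rat := #|[set s | E s]|%:R / #|{: perms}|%:R.

Definition early_prob (k : nat) : rat := (m ^_ k)%:R / (N ^_ k)%:R.

Lemma card_perms_gt0 : 0 < #|{: perms}|%:R :> rat.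
Proof. by rewrite ltr0n card_Sn fact_gt0. Qed.

Lemma pr_sum (E : pred perms) : pr E = (\sum_s (E s)%:R) / #|{: perms}|%:R.
Proof.
congr (_ / _); rewrite -sum1_card natr_sum big_mkcond /=.
by apply: eq_bigr => s _; rewrite inE; case: (E s).
Qed.

Lemma pr_early (A : {set 'I_N}) : pr (fun s => A \subset early m s) = early_prob #|A|.
Proof.
have cA : (#|A| <= N)%N by rewrite -[X in (_ <= X)%N]card_ord max_card.
have nz : (N ^_ #|A|)%:R != 0 :> rat by rewrite pnatr_eq0 -lt0n ffact_gt0.
apply/eqP; rewrite /pr /early_prob eqr_div //; last by rewrite gt_eqF ?card_perms_gt0.
by rewrite card_Sn -!natrM count_earlyE // mulnC.
Qed.

Lemma pr_union (I : finType) (P : pred I) (E : I -> pred perms) (F : pred perms) :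
  (forall s, F s -> exists2 i, P i & E i s) -> pr F <= \sum_(i | P i) pr (E i).
Proof.
move=> h; rewrite pr_sum (eq_bigr _ (fun i _ => pr_sum (E i))).
rewrite -mulr_suml ler_wpM2r ?invr_ge0 ?ler0n // exchange_big /=.
apply: ler_sum => s _; case: (boolP (F s)) => [/h[i Pi Ei]|_]; last exact: sumr_ge0.
by rewrite (bigD1 i) //= Ei lerDl sumr_ge0.
Qed.

Lemma early_prob_le k : (k <= N)%N -> early_prob k <= (m%:R / N%:R) ^+ k.
Proof.
move=> kN; have N0 : (0 < N)%N := leq_ltn_trans (leq0n _) (ltn_ord k0).
rewrite /early_prob expr_div_n ler_pdivrMr ?ltr0n ?ffact_gt0 // mulrAC.
by rewrite ler_pdivlMr ?exprn_gt0 ?ltr0n // -!natrX -!natrM ler_nat ffact_exp_cross.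
Qed.

(** Negative correlation of two disjoint sets of [k] edges. *)
Lemma early_prob_double k : (k + k <= N)%N -> early_prob (k + k) <= early_prob k ^+ 2.
Proof.
move=> kN; have k1 : (k <= N)%N by apply: leq_trans kN; apply: leq_addr.
have g1 : (0 < N ^_ k)%N by rewrite ffact_gt0.
have g2 : (0 < N ^_ (k + k))%N by rewrite ffact_gt0.
rewrite /early_prob expr_div_n ler_pdivrMr ?ltr0n // mulrAC ler_pdivlMr ?exprn_gt0 ?ltr0n //.
rewrite -!natrX -!natrM ler_nat !ffactD !expnS !expn0 !muln1.
have := @ffact_double_cross m N k k mN.
move: (m ^_ k)%N (N ^_ k)%N ((m - k) ^_ k)%N ((N - k) ^_ k)%N => a b c d h.
have -> : (a * c * (b * b) = (a * b) * (c * b))%N by ring.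
have -> : (a * a * (b * d) = (a * b) * (d * a))%N by ring.
by rewrite leq_mul2l h orbT.
Qed.

Variables (t : nat) (c : rat).
Hypotheses (t0 : (0 < t)%N) (c1 : 1 <= c) (nt : (n <= (2 * t) ^ 10)%N)
  (mc : m%:R / N%:R <= c / t%:R ^+ 7).

(** Lowering the exponent j to k is allowed since m/N <= 1, and lowering 7k to d since t >= 1. *)
Lemma mN_pow k j (d : nat) : (k <= j)%N -> (d <= 7 * k)%N ->
  (m%:R / N%:R) ^+ j <= c ^+ k / t%:R ^+ d.
Proof.
move=> kj dk; have N0 : (0 < N)%N := leq_ltn_trans (leq0n _) (ltn_ord k0).
have x0 : 0 <= m%:R / N%:R :> rat by rewrite divr_ge0.
have x1 : m%:R / N%:R <= 1 :> rat by rewrite ler_pdivrMr ?ltr0n // mul1r ler_nat.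
have c0 : 0 <= c by apply: le_trans c1.
apply: le_trans (_ : (m%:R / N%:R) ^+ k <= _); first by rewrite ler_wiXn2l.
apply: le_trans (_ : (c / t%:R ^+ 7) ^+ k <= _).
  by rewrite lerXn2r ?nnegrE ?x0 // divr_ge0 // exprn_ge0 ?ler0n.
rewrite expr_div_n -exprM; apply: ler_wpM2l; first by rewrite exprn_ge0.
by rewrite lef_pV2 ?posrE ?exprn_gt0 ?ltr0n // ler_weXn2l // ler1n.
Qed.

Definition sparseb (s : perms) := [forall S : {set 'I_n},
  (#|S| <= 23)%N ==> (7 * narcs (Gproc s m) S <= 20 * #|S|)%N].

Lemma sparsebP s : reflect (sparse (Gproc s m) 23) (sparseb s).
Proof.
apply: (iffP forallP) => h S; first by move/implyP: (h S).
by apply/implyP; apply: h.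
Qed.

Lemma narcs_Gproc (s : perms) (S : {set 'I_n}) :
  narcs (Gproc s m) S = (2 * #|eixp k0 @: arcs (Gproc s m) S|)%N.
Proof.
apply: card_eix => x y; rewrite !inE /= => /and3P[-> -> h].
by rewrite (Gproc_sym k0) h; move: h; rewrite (GprocE k0) => /andP[-> _].
Qed.

(** Union bound over vertex sets S and over edge sets inside S with more than 10|S|/7 elements. Each
    such edge set is present with probability at most c^33 / t^(10|S| + 1), there are at most 2^e of
    them in S, and at most 2^e t^(10|S|) sets S of a given size; a factor 1/t is left for each of
    the 24 sizes. *)
Lemma pr_not_sparse e : (23 ^ 2 <= e)%N ->
  pr (fun s => ~~ sparseb s) <= 24%:R * (2 ^+ e * 2 ^+ e) * c ^+ 33 / t%:R.
Proof.
move=> e529; pose EI (S : {set 'I_n}) := eixp k0 @: setX S S.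
have cEI S : (#|EI S| <= #|S| ^ 2)%N.
  by apply: leq_trans (leq_imset_card _ _) _; rewrite cardsX expnS expn1.
have one (S : {set 'I_n}) : (#|S| < 24)%N ->
    pr (fun s => 20 * #|S| < 7 * narcs (Gproc s m) S)%N <=
    2 ^+ e * (c ^+ 33 / t%:R ^+ (10 * #|S|).+1).
  move=> S24.
  have u := @pr_union _ [pred A : {set 'I_N} | (A \subset EI S) && (10 * #|S| < 7 * #|A|)%N]
    (fun A s => A \subset early m s) (fun s => 20 * #|S| < 7 * narcs (Gproc s m) S)%N.
  apply: le_trans (u _) _.
    move=> s h; exists (eixp k0 @: arcs (Gproc s m) S).
      rewrite inE; apply/andP; split; last first.
        have half a b : (20 * a < 7 * (2 * b) -> 10 * a < 7 * b)%N by clear; lia.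
        by apply: half; rewrite -narcs_Gproc.
      by apply: imsetS; apply/subsetP=> d; rewrite !inE => /and3P[-> -> _].
    apply/subsetP=> k /imsetP[[x y]]; rewrite !inE /= => /and3P[_ _].
    by rewrite (GprocE k0) => /andP[_ h'] ->.
  have c0 : 0 <= c ^+ 33 / t%:R ^+ (10 * #|S|).+1.
    by rewrite divr_ge0 ?exprn_ge0 ?ler0n // (le_trans _ c1).
  apply: le_trans (_ : \sum_(A | A \in powerset (EI S)) c ^+ 33 / t%:R ^+ (10 * #|S|).+1 <= _).
    rewrite big_mkcond [X in _ <= X]big_mkcond /=; apply: ler_sum => A _.
    rewrite !inE; case: (A \subset EI S) => //=; case: ifP => // hA.
    rewrite pr_early; apply: le_trans (early_prob_le _) _.
      by rewrite -[X in (_ <= X)%N]card_ord max_card.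
    (* The edge set has at least floor(10|S|/7) + 1 elements, and 7 times this number is at least
       10|S| + 1. For |S| <= 23 it is at most 33. *)
    apply: le_trans (@mN_pow ((10 * #|S|) %/ 7).+1 _ (10 * #|S|).+1 _ _) _.
    - by rewrite ltn_divLR // [X in (_ < X)%N]mulnC.
    - by rewrite [X in (_ < X)%N]mulnC ltn_ceil.
    apply: ler_wpM2r; first by rewrite invr_ge0 exprn_ge0.
    by apply: ler_weXn2l => //; rewrite ltn_divLR //; clear -S24; lia.
  rewrite sumr_const card_powerset -[X in X <= _]mulr_natl natrX; apply: ler_wpM2r => //.
  apply: ler_weXn2l; first by rewrite ler1n.
  by apply: leq_trans (cEI S) _; apply: leq_trans e529; rewrite leq_exp2r.
have u := @pr_union _ [pred S : {set 'I_n} | (#|S| < 24)%N]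
  (fun S s => 20 * #|S| < 7 * narcs (Gproc s m) S)%N (fun s => ~~ sparseb s).
apply: le_trans (u _) _.
  move=> s /forallPn[S]; rewrite negb_imply -ltnNge => /andP[h1 h2].
  by exists S.
apply: le_trans (ler_sum _ (fun S hS => one S hS)) _.
rewrite (partition_big (fun S : {set 'I_n} => inord #|S| : 'I_24) xpredT) //=.
have tp : 0 < t%:R :> rat by rewrite ltr0n.
have -> : 24%:R * (2 ^+ e * 2 ^+ e) * c ^+ 33 / t%:R =
    \sum_(j < 24) (2 ^+ e * 2 ^+ e) * (c ^+ 33 / t%:R) :> rat.
  by rewrite sumr_const card_ord -[RHS]mulr_natl !mulrA.
apply: ler_sum => j _.
apply: le_trans (_ : \sum_(S : {set 'I_n} | #|S| == j)
    2 ^+ e * (c ^+ 33 / t%:R ^+ (10 * j).+1) <= _).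
  rewrite big_mkcond [X in _ <= X]big_mkcond /=; apply: ler_sum => S _.
  case: ifP => [/andP[S24 /eqP eS]|_].
    have ej : #|S| = j by rewrite -eS inordK.
    by rewrite ej eqxx.
  by case: ifP => // _; rewrite mulr_ge0 ?divr_ge0 ?exprn_ge0 ?ler0n // (le_trans _ c1).
rewrite sumr_const -[X in X <= _]mulr_natl.
have -> : #|[pred S : {set 'I_n} | #|S| == j]| = 'C(n, j).
  by rewrite -[n in RHS]card_ord -card_draws cardsE; apply: eq_card => S; rewrite !inE.
(* As n <= (2t)^10, the surplus is 2^(10j), absorbed by 2^e because 10j <= 230 <= 23^2. *)
have b : ('C(n, j))%:R <= 2 ^+ e * t%:R ^+ (10 * j) :> rat.
  rewrite -!natrX -natrM ler_nat; apply: leq_trans (bin_le_exp _ _) _.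
  apply: leq_trans (_ : ((2 * t) ^ 10) ^ j <= _)%N; first by apply: leq_exp2.
  rewrite expnMn expnMn -!expnM leq_mul2r leq_exp2l //; apply/orP; right.
  have j23 : (j <= 23)%N by rewrite -ltnS.
  by apply: leq_trans e529; clear -j23; lia.
have tz : t%:R != 0 :> rat by rewrite gt_eqF.
have -> : 2 ^+ e * 2 ^+ e * (c ^+ 33 / t%:R) =
    2 ^+ e * t%:R ^+ (10 * j) * (2 ^+ e * (c ^+ 33 / t%:R ^+ (10 * j).+1)) :> rat.
  rewrite [t%:R ^+ _.+1]exprS; set y := t%:R ^+ (10 * j).
  have yz : y != 0 by rewrite expf_neq0.
  by move: (2 ^+ e) (c ^+ 33) => a a'; field; rewrite yz tz.
apply: ler_wpM2r => //.
by rewrite mulr_ge0 ?divr_ge0 ?exprn_ge0 ?ler0n // (le_trans _ c1).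
Qed.

(** * The second moment of the number of copies of DD *)

Definition edge_set (f : {ffun 'I_7 -> 'I_n}) : {set 'I_N} := eixp k0 @: copy_of DD f.

Lemma copy_sym (f : {ffun 'I_7 -> 'I_n}) x y : injective f ->
  (x, y) \in copy_of DD f -> (x != y) && ((y, x) \in copy_of DD f).
Proof.
move=> fI; rewrite !inE => /existsP[u /existsP[v /andP[d /eqP[-> ->]]]].
rewrite (inj_eq fI); apply/andP; split.
  by apply: contraTneq d => ->; case: v => [[|[|[|[|[|[|[|//]]]]]]] i].
by apply/existsP; exists v; apply/existsP; exists u; rewrite DD_sym d eqxx.
Qed.

Lemma card_edge_set (f : {ffun 'I_7 -> 'I_n}) : injective f -> #|edge_set f| = 10%N.
Proof.
move=> fI; have := card_eix k0 (C := copy_of DD f) (fun x y => copy_sym fI).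
by rewrite card_copy // => e; apply/eqP; rewrite -(eqn_pmul2l (m := 2)) // -e.
Qed.

(** Shared edges pull back to edges of DD inside the set of shared vertices, where balance bounds
    their number. *)
Lemma card_edge_setI (f g : {ffun 'I_7 -> 'I_n}) : injective f -> injective g ->
  (7 * #|edge_set f :&: edge_set g| <= 10 * #|[set i | g i \in codom f]|)%N.
Proof.
move=> fI gI; set W := [set i | _].
have -> : edge_set f :&: edge_set g = eixp k0 @: (copy_of DD f :&: copy_of DD g).
  apply/setP=> k; rewrite inE; apply/andP/imsetP => [[]|[e]]; last first.
    by rewrite inE => /andP[ef eg] ->; split; apply: imset_f.
  case/imsetP=> -[x y] xyf -> /imsetP[[x' y'] xyg e].
  have /andP[ne yxf] := copy_sym fI xyf; have /andP[ne' yxg] := copy_sym gI xyg.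
  exists (x, y) => //; rewrite in_setI xyf.
  by case: (eix_inj ne ne' e) => ->.
have h1 : (#|copy_of DD f :&: copy_of DD g| <= #|arcs DD W|)%N := card_copyI f g.
have h2 : (7 * #|arcs DD W| <= 20 * #|W|)%N.
  have := DD_balanced W; case: ifP => [/eqP-> /eqP-> //|_ /orP[/eqP w0|/ltnW //]].
  suff -> : arcs DD W = set0 by rewrite cards0 muln0.
  move/eqP: w0; rewrite cards_eq0 => /eqP->.
  by apply/setP=> e; rewrite !inE.
have := card_eix k0 (C := copy_of DD f :&: copy_of DD g).
move: h1 h2; move: #|_ :&: _| #|arcs _ _| #|W| #|_ @: _| => a b d e h1 h2 h3.
rewrite -(leq_pmul2l (m := 2)) // mulnCA -h3.
  by clear -h1 h2; lia.
move=> x y; rewrite !in_setI => /andP[/(copy_sym fI)/andP[-> ->] /(copy_sym gI)/andP[_ ->]].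
by [].
Qed.

(** The weight is a product over the 7 vertices of DD, so the sum over all maps [g] is the 7th power
    of a sum over single vertices, which is at most 7t^10 + n <= (7 + 2^10) t^10. *)
Lemma sum_overlap (b : nat) (f : {ffun 'I_7 -> 'I_n}) : (7 + 2 ^ 10 <= b)%N ->
  (\sum_(g : {ffun 'I_7 -> 'I_n}) t ^ (10 * #|[set i | g i \in codom f]|) <=
   (b * t ^ 10) ^ 7)%N.
Proof.
move=> hb.
have -> : (\sum_(g : {ffun 'I_7 -> 'I_n}) t ^ (10 * #|[set i | g i \in codom f]|) =
    \sum_(g : {ffun 'I_7 -> 'I_n}) \prod_(i < 7) (if g i \in codom f then t ^ 10 else 1))%N.
  apply: eq_bigr => g _; rewrite -big_mkcond /= prod_nat_const expnM.
  by congr (_ ^ _)%N; apply: eq_card => i; rewrite !inE.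
rewrite -(bigA_distr_bigA (fun (i : 'I_7) x => if x \in codom f then t ^ 10 else 1)%N) /=.
rewrite prod_nat_const card_ord; apply: leq_exp2.
apply: leq_trans (_ : \sum_(x : 'I_n) ((x \in codom f) * t ^ 10 + 1) <= _)%N.
  by apply: leq_sum => x _; case: ifP => _; rewrite ?mul1n ?leq_addr // leq_addl.
rewrite big_split /= -big_distrl /= sum1_card card_ord.
have c7 : (\sum_(x : 'I_n) (x \in codom f) <= 7)%N.
  apply: leq_trans (_ : #|codom f| <= 7)%N; last first.
    by apply: leq_trans (card_size _) _; rewrite size_codom card_ord.
  by rewrite -sum1_card [X in (_ <= X)%N]big_mkcond /=; apply: leq_sum => x _; case: ifP.
apply: leq_trans (_ : 7 * t ^ 10 + 2 ^ 10 * t ^ 10 <= _)%N; last first.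
  by rewrite -mulnDl leq_mul2r hb orbT.
by apply: leq_add; rewrite ?leq_mul2r ?c7 ?orbT // -expnMn.
Qed.

(** Without a common edge, negative correlation gives the first term. With j >= 1 common edges and v
    common vertices, 7j <= 10v turns (c/t^7)^(20-j) into the second term. *)
Lemma early_prob_pair (f g : {ffun 'I_7 -> 'I_n}) : injective f -> injective g ->
  early_prob #|edge_set f :|: edge_set g| <= early_prob 10 ^+ 2 +
    c ^+ 19 / t%:R ^+ (7 * 20) * (t ^ (10 * #|[set i | g i \in codom f]|))%:R.
Proof.
move=> fI gI; have hj := card_edge_setI fI gI.
set v := #|[set i | _]| in hj *; set j := #|_ :&: _| in hj.
have cN (A : {set 'I_N}) : (#|A| <= N)%N by rewrite -[X in (_ <= X)%N]card_ord max_card.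
have c0 : 0 <= c by apply: le_trans c1.
have tp : 0 < t%:R :> rat by rewrite ltr0n.
have cU : #|edge_set f :|: edge_set g| = (20 - j)%N.
  by rewrite cardsU !card_edge_set.
have := cN (edge_set f :|: edge_set g); rewrite cU.
have [->|j0] := posnP j => kN.
  rewrite subn0 in kN *; apply: le_trans (early_prob_double (k := 10) kN) _.
  by rewrite lerDl mulr_ge0 ?ler0n // divr_ge0 // exprn_ge0 // ltW.
have j10 : (j <= 10)%N.
  by rewrite -(card_edge_set fI); apply: subset_leq_card; apply: subsetIl.
apply: le_trans (_ : c ^+ 19 / t%:R ^+ (7 * 20) * (t ^ (10 * v))%:R <= _); last first.
  by rewrite lerDr sqr_ge0.
apply: le_trans (early_prob_le kN) _.
apply: le_trans (@mN_pow (20 - j) _ (7 * (20 - j)) _ _) _ => //.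
rewrite natrX mulrAC ler_pdivlMr ?exprn_gt0 // mulrAC ler_pdivrMr ?exprn_gt0 //.
rewrite -mulrA -exprD; apply: ler_pM.
- by rewrite exprn_ge0.
- by rewrite exprn_ge0 // ltW.
- by apply: ler_weXn2l => //; clear -j0; lia.
apply: ler_weXn2l; first by rewrite ler1n.
by clear -hj j10; lia.
Qed.

(** Embeddings are counted, so a copy counts once for each automorphism of DD. *)
Definition ncopies (s : perms) : rat :=
  \sum_(f : {ffun 'I_7 -> 'I_n} | injectiveb f) (edge_set f \subset early m s)%:R.

Definition mu : rat := (n ^_ 7)%:R * early_prob 10.

Lemma card_injective7 : #|[pred f : {ffun 'I_7 -> 'I_n} | injectiveb f]| = (n ^_ 7)%N.
Proof.
have := card_inj_ffuns 'I_7 'I_n; rewrite !card_ord => <-.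
by apply: eq_card => f; rewrite !inE.
Qed.

Lemma pr_mean (I : finType) (P : pred I) (A : I -> {set 'I_N}) :
  \sum_s \sum_(i | P i) (A i \subset early m s)%:R =
  #|{: perms}|%:R * \sum_(i | P i) early_prob #|A i| :> rat.
Proof.
rewrite exchange_big mulr_sumr; apply: eq_bigr => i _.
by rewrite -pr_early pr_sum mulrC divfK // gt_eqF // card_perms_gt0.
Qed.

Lemma first_moment : \sum_s ncopies s = #|{: perms}|%:R * mu.
Proof.
rewrite pr_mean; congr (_ * _); rewrite (eq_bigr (fun=> early_prob 10)).
  by rewrite /mu sumr_const card_injective7 mulr_natl.
by move=> f /injectiveP fI; rewrite card_edge_set.
Qed.

(** Sum the bound for pairs. The first terms give mu^2; in the others the overlap sum and n <=
    (2t)^10 give at most b^14 t^140, which cancels the denominator t^140. *)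
Lemma second_moment (b : nat) : (7 + 2 ^ 10 <= b)%N ->
  \sum_s ncopies s ^+ 2 <= #|{: perms}|%:R * (mu ^+ 2 + b%:R ^+ 14 * c ^+ 19).
Proof.
move=> hb.
have -> : \sum_s ncopies s ^+ 2 = \sum_s \sum_(p : {ffun 'I_7 -> 'I_n} * {ffun 'I_7 -> 'I_n} |
    injectiveb p.1 && injectiveb p.2) (edge_set p.1 :|: edge_set p.2 \subset early m s)%:R.
  apply: eq_bigr => s _; rewrite expr2 /ncopies mulr_suml.
  under eq_bigr do rewrite mulr_sumr.
  rewrite pair_big /=; apply: eq_bigr => -[f g] _ /=.
  by rewrite subUset -natrM mulnb.
rewrite pr_mean ler_wpM2l ?ler0n //.
rewrite -(pair_big (fun f : {ffun 'I_7 -> 'I_n} => injectiveb f)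
  (fun g : {ffun 'I_7 -> 'I_n} => injectiveb g)
  (fun f g => early_prob #|edge_set f :|: edge_set g|)) /=.
pose K := c ^+ 19 / t%:R ^+ (7 * 20).
have K0 : 0 <= K by rewrite divr_ge0 ?exprn_ge0 ?ler0n // (le_trans _ c1).
apply: le_trans (_ : \sum_(f : {ffun 'I_7 -> 'I_n} | injectiveb f)
    ((n ^_ 7)%:R * early_prob 10 ^+ 2 + K * ((b * t ^ 10) ^ 7)%:R) <= _).
  apply: ler_sum => f /injectiveP fI.
  apply: le_trans (_ : \sum_(g : {ffun 'I_7 -> 'I_n} | injectiveb g) (early_prob 10 ^+ 2 +
      K * (t ^ (10 * #|[set i | g i \in codom f]|))%:R) <= _).
    by apply: ler_sum => g /injectiveP gI; apply: early_prob_pair.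
  rewrite big_split /= sumr_const card_injective7 -[early_prob 10 ^+ 2 *+ _]mulr_natl lerD2l.
  rewrite -mulr_sumr ler_wpM2l // -natr_sum ler_nat.
  apply: leq_trans (sum_overlap f hb); rewrite big_mkcond /=.
  by apply: leq_sum => g _; case: ifP.
rewrite sumr_const card_injective7 -[X in X <= _]mulr_natl mulrDr.
have -> : (n ^_ 7)%:R * ((n ^_ 7)%:R * early_prob 10 ^+ 2) = mu ^+ 2 by rewrite /mu; ring.
rewrite lerD2l mulrCA.
have tp : 0 < t%:R :> rat by rewrite ltr0n.
have h : (n ^_ 7 * (b * t ^ 10) ^ 7 <= b ^ 14 * t ^ (7 * 20))%N.
  have -> : (b ^ 14 * t ^ (7 * 20) = (b * t ^ 10) ^ 7 * (b * t ^ 10) ^ 7)%N.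
    by rewrite -expnD expnMn -expnM.
  rewrite leq_mul2r; apply/orP; right; apply: leq_trans (ffact_le_exp _ _) _.
  apply: leq_exp2; apply: leq_trans nt _; rewrite expnMn leq_mul2r.
  by rewrite (leq_trans (leq_addl _ _) hb) orbT.
rewrite -natrM; apply: le_trans (_ : K * (b ^ 14 * t ^ (7 * 20))%:R <= _).
  by apply: ler_wpM2l => //; rewrite ler_nat.
rewrite natrM !natrX /K mulrCA ler_wpM2l ?exprn_ge0 ?ler0n //.
by rewrite divfK // expf_neq0 // gt_eqF.
Qed.

(** On this event the count is at most mu/2, so its squared deviation is at least mu^2/4, while the
    variance is at most b^14 c^19. *)
Lemma chebyshev (b : nat) (L : rat) : (7 + 2 ^ 10 <= b)%N -> 0 < mu -> 2 * L <= mu ->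
  pr (fun s => ncopies s <= L) <= 4 * (b%:R ^+ 14 * c ^+ 19) / mu ^+ 2.
Proof.
move=> hb mu0 hL.
have sm := second_moment hb; have fm := first_moment.
move: (b%:R ^+ 14 * c ^+ 19) sm => R sm.
have P0 := card_perms_gt0.
have var : \sum_s (ncopies s - mu) ^+ 2 <= #|{: perms}|%:R * R.
  have -> : \sum_s (ncopies s - mu) ^+ 2 = \sum_s ncopies s ^+ 2 - 2 * mu * \sum_s ncopies s
      + #|{: perms}|%:R * mu ^+ 2.
    have -> : #|{: perms}|%:R * mu ^+ 2 = \sum_(s : perms) mu ^+ 2.
      by rewrite sumr_const mulr_natl.
    by rewrite mulr_sumr -sumrB -big_split /=; apply: eq_bigr => s _; ring.
  rewrite fm; lra.
rewrite ler_pdivlMr ?exprn_gt0 // pr_sum mulrAC ler_pdivrMr //.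
apply: le_trans (_ : 4 * \sum_s (ncopies s - mu) ^+ 2 <= _); last by lra.
rewrite mulr_suml mulr_sumr; apply: ler_sum => s _.
case: (boolP (ncopies s <= L)) => h /=; last by rewrite mul0r mulr_ge0 ?sqr_ge0.
by rewrite mul1r; nra.
Qed.

End Probability.

(** * The hitting times *)

Section Process.
Variables (n : nat) (k0 : 'I_(nedges n)) (s : {perm 'I_(nedges n)}).

Lemma Gproc_mono i j x y : i <= j -> Gproc s i x y -> Gproc s j x y.
Proof. by move=> ij; rewrite !(GprocE k0) => /andP[-> h] /=; apply: leq_trans ij. Qed.

Lemma sparse_mono (G H : rel 'I_n) K : (forall x y, G x y -> H x y) ->
  sparse H K -> sparse G K.
Proof.
move=> GH sp S cS; apply: leq_trans (sp S cS); rewrite leq_mul2l /=.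
apply: subset_leq_card; apply/subsetP=> -[x y]; rewrite !inE /= => /and3P[-> -> /GH].
by [].
Qed.

Lemma embeds_mono (G H : rel 'I_n) f : (forall x y, G x y -> H x y) ->
  embeds DD G f -> embeds DD H f.
Proof.
move=> GH /andP[fI /forallP h]; rewrite /embeds fI /=.
apply/forallP=> u; apply/forallP=> v; apply/implyP=> d; apply: GH.
by move/forallP: (h u) => /(_ v)/implyP; apply.
Qed.

Variable m : nat.

(** Embeddings with the same copy as [f0] map into its 7 vertices, as DD has no isolated vertex; so
    there are at most 7^7 of them. *)
Lemma contains_2_of_many (L : nat) : 7 ^ 7 <= L -> (L%:R < ncopies k0 m s)%R ->
  contains_k DD 2 (Gproc s m).
Proof.
move=> hL.
pose Q := [set f : {ffun 'I_7 -> 'I_n} | injectiveb f && (edge_set k0 f \subset early m s)].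
have -> : ncopies k0 m s = #|Q|%:R%R.
  rewrite -sum1_card natr_sum /ncopies big_mkcond [RHS]big_mkcond /=.
  by apply: eq_bigr => f _; rewrite inE; case: (injectiveb f) => //=; case: (_ \subset _).
rewrite ltr_nat => LQ; apply/contains_2P.
have emb f : f \in Q -> embeds DD (Gproc s m) f.
  rewrite inE => /andP[/injectiveP fI /subsetP sub].
  apply/andP; split; first exact/injectiveP.
  apply/forallP=> u; apply/forallP=> v; apply/implyP=> d; rewrite (GprocE k0).
  have c : (f u, f v) \in copy_of DD f.
    by rewrite inE; apply/existsP; exists u; apply/existsP; exists v; rewrite d eqxx.
  have /andP[-> _] := copy_sym fI c; rewrite /=.
  have : eixp k0 (f u, f v) \in early m s by apply: sub; apply: imset_f.
  by rewrite inE.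
have [f0 f0Q] : exists f0, f0 \in Q.
  by apply/set0Pn; rewrite -card_gt0; apply: leq_trans LQ.
have [g gQ ne] : exists2 g, g \in Q & copy_of DD f0 != copy_of DD g.
  apply/exists_inP; apply: contraT => /exists_inPn all_eq.
  suff : #|Q| <= L by rewrite leqNgt LQ.
  apply: leq_trans hL.
  have sub : Q \subset ffun_on (mem (codom f0)).
    apply/subsetP=> f /all_eq; rewrite negbK => /eqP e.
    apply/ffun_onP => i; have [j d] : exists j, DD i j.
      by case: i => [[|[|[|[|[|[|[|//]]]]]]] i];
        [exists (o7 1)|exists (o7 0)..].
    have : (f i, f j) \in copy_of DD f0.
      by rewrite e inE; apply/existsP; exists i; apply/existsP; exists j; rewrite d eqxx.
    by rewrite inE => /existsP[u /existsP[v /andP[_ /eqP[-> _]]]]; apply: codom_f.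
  apply: leq_trans (subset_leq_card sub) _; rewrite card_ffun_on card_ord leq_exp2 //.
  by apply: leq_trans (card_size _) _; rewrite size_codom card_ord.
by exists f0, g; split=> //; apply: emb.
Qed.

Hypotheses (sp : sparse (Gproc s m) 23) (two : contains_k DD 2 (Gproc s m)).

(** The two properties agree at every time: up to [m] because sparsity passes to subgraphs, after
    [m] because both hold. *)
Lemma tau_Maker1 : tau Maker1 s = tau (contains_k DD 1) s.
Proof.
apply: eq_find => i; have [im|mi] := leqP i m.
  apply: (Maker1E (Gproc_sym k0 s i) (Gproc_irr k0 s i)).
  by apply: sparse_mono sp => x y; apply: Gproc_mono.
have c1 : contains_k DD 1 (Gproc s i).
  case/contains_2P: two => f [g [ef _ _]]; apply/contains_1P; exists f.
  by apply: embeds_mono ef => x y; apply: Gproc_mono; apply: ltnW.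
by rewrite c1 Maker1_of_DD.
Qed.

Lemma tau_Maker2 : tau Maker2 s = tau (contains_k DD 2) s.
Proof.
case/contains_2P: two => f [g [ef eg ne]].
have n0 : 0 < n by apply: leq_trans (embeds_card ef).
apply: eq_find => i; have [im|mi] := leqP i m.
  apply: (Maker2E (Gproc_sym k0 s i) (Gproc_irr k0 s i)) => //.
  by apply: sparse_mono sp => x y; apply: Gproc_mono.
have up h : embeds DD (Gproc s m) h -> embeds DD (Gproc s i) h.
  by apply: embeds_mono => x y; apply: Gproc_mono; apply: ltnW.
rewrite (Maker2_of_disjoint_DD (up _ ef) (up _ eg) (copies_disjoint sp ef eg ne)).
by apply/esym/contains_2P; exists f, g; split; rewrite ?up.
Qed.

End Process.

(** * Choice of the constants and the limit *)

Lemma root10 (n t0 : nat) : t0 ^ 10 <= n -> 0 < t0 ->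
  exists t, [/\ t0 <= t, t ^ 10 <= n & n <= (2 * t) ^ 10].
Proof.
move=> h t00.
have ex : exists t, t ^ 10 <= n by exists t0.
have ub t : t ^ 10 <= n -> t <= n.
  by move=> ht; apply: leq_trans ht; case: t => // t; rewrite -{1}[t.+1]expn1 leq_pexp2l.
(* For the largest t with t^10 <= n, also n < (t+1)^10 <= (2t)^10. *)
case: (ex_maxnP ex ub) => t ht tmax; exists t; split=> //; first exact: tmax.
apply: ltnW; apply: leq_trans (_ : t.+1 ^ 10 <= _).
  by rewrite ltnNge; apply/negP=> /tmax; rewrite ltnn.
apply: leq_exp2; have := tmax _ h; lia.
Qed.

(** The mean n^7 (m/N)^10 is of order w^10: falling factorials cost 2^7 and 2^10, N is at most n^2,
    and n^13 <= 2^130 t^130 cancels the t^130 in m^10. *)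
Lemma mu_lower (n w t m : nat) (k0 : 'I_(nedges n)) (D : nat) :
  2 ^ 10 * 2 ^ 7 * 2 ^ 130 <= D ->
  m = w * t ^ 13 -> 20 <= m -> 14 <= n -> 10 <= nedges n -> n <= (2 * t) ^ 10 ->
  ((w ^ 10)%:R <= D%:R * mu n m)%R.
Proof.
move=> hD em m20 n14 N10 nt; rewrite /mu /early_prob.
rewrite !mulrA ler_pdivlMr ?ltr0n ?ffact_gt0 // -!natrM ler_nat.
have Nn : nedges n <= n ^ 2.
  have := nedgesE k0; have : n * n.-1 <= n ^ 2 by rewrite expnS expn1 leq_mul2l leq_pred orbT.
  by clear; lia.
have h1 := exp_le_ffact (n14 : 2 * 7 <= n).
have h2 := exp_le_ffact (m20 : 2 * 10 <= m).
have h3 : nedges n ^_ 10 <= n ^ 13 * n ^ 7.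
  apply: leq_trans (ffact_le_exp _ _) _.
  have -> : n ^ 13 * n ^ 7 = (n ^ 2) ^ 10 by rewrite -expnD -expnM.
  exact: leq_exp2.
have h4 : n ^ 13 <= 2 ^ 130 * t ^ 130.
  have -> : 2 ^ 130 * t ^ 130 = ((2 * t) ^ 10) ^ 13 by rewrite -expnM -expnMn.
  exact: leq_exp2.
have h5 : w ^ 10 * t ^ 130 = m ^ 10 by rewrite em expnMn -expnM.
apply: leq_trans (_ : w ^ 10 * (2 ^ 130 * t ^ 130 * n ^ 7) <= _).
  by rewrite leq_mul2l; apply/orP; right; apply: leq_trans h3 _; rewrite leq_mul2r h4 orbT.
have -> : w ^ 10 * (2 ^ 130 * t ^ 130 * n ^ 7) = 2 ^ 130 * (m ^ 10 * n ^ 7).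
  rewrite -h5; move: (w ^ 10) (2 ^ 130) (t ^ 130) (n ^ 7) => a b c d; ring.
apply: leq_trans (_ : 2 ^ 130 * ((2 ^ 10 * m ^_ 10) * (2 ^ 7 * n ^_ 7)) <= _).
  by rewrite leq_mul2l; apply/orP; right; apply: leq_mul.
apply: leq_trans (_ : 2 ^ 10 * 2 ^ 7 * 2 ^ 130 * n ^_ 7 * m ^_ 10 <= _); last first.
  by rewrite -2![_ * _ * m ^_ 10]mulnA leq_mul2r hD orbT.
move: (2 ^ 130) (2 ^ 10) (2 ^ 7) (m ^_ 10) (n ^_ 7) => a b c d e.
by apply: eq_leq; ring.
Qed.

Section Asymptotics.
Local Open Scope ring_scope.

Lemma exists_nat_ge (x : rat) : exists k : nat, x <= k%:R.
Proof.
exists (Num.bound `|x|); apply: le_trans (ler_norm x) _.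
exact/ltW/archi_boundP/normr_ge0.
Qed.

(** The variance bound grows like c^19 with c = 4w, but mu^2 like w^20, so Chebyshev's bound is
    O(1/w). *)
Lemma ratio_bound (B F w D M : rat) : 0 <= B -> 0 <= F -> 0 < w -> 0 < M ->
  w ^+ 10 <= D * M ->
  4 * (B * (F * w ^+ 19)) / M ^+ 2 <= 4 * (B * F) * D ^+ 2 / w.
Proof.
move=> B0 F0 w0 M0 h.
have M2 : 0 < M ^+ 2 by rewrite exprn_gt0.
rewrite ler_pdivrMr // [X in _ <= X]mulrAC ler_pdivlMr //.
have sq : (w ^+ 10) ^+ 2 <= (D * M) ^+ 2.
  have w10 : 0 <= w ^+ 10 by rewrite exprn_ge0 // ltW.
  by rewrite lerXn2r // nnegrE // (le_trans w10).
have -> : 4 * (B * (F * w ^+ 19)) * w = 4 * (B * F) * (w ^+ 10) ^+ 2 by ring.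
by rewrite -[X in _ <= X]mulrA -exprMn ler_wpM2l // mulr_ge0 // mulr_ge0 //.
Qed.

Lemma good_whp (L : nat) (eps : rat) : 0 < eps -> exists N0 : nat, forall n, (N0 <= n)%N ->
  exists (k0 : 'I_(nedges n)) (m : nat),
    pr (fun s => ~~ sparseb m s || (ncopies k0 m s <= L%:R)) <= eps.
Proof.
move=> eps0.
(* Abstracting the large constants keeps conversion from evaluating them. *)
have [e he] : exists e, (23 ^ 2 <= e)%N by exists (23 ^ 2)%N.
have [b hb] : exists b, (7 + 2 ^ 10 <= b)%N by exists (7 + 2 ^ 10)%N.
have [D hD D0] : exists2 D, (2 ^ 10 * 2 ^ 7 * 2 ^ 130 <= D)%N & (0 < D)%N.
  by eexists; [apply: leqnSn | apply: ltn0Sn].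
have [z ez] : exists z : rat, z = 4 by eexists.
have z0 : 0 <= z by rewrite ez.
have [K2 eK2] : exists K : rat, K = 4 * (b%:R ^+ 14 * z ^+ 19) * D%:R ^+ 2 by eexists.
(* This [w] makes Chebyshev's bound at most eps/2 and the mean at least 2L, uniformly in [n]. *)
have [w hw] := exists_nat_ge (1 + 2 * D%:R * L%:R + 2 * K2 / eps).
have [c ec] : exists c : rat, c = z * w%:R by eexists.
have [K1 eK1] : exists K : rat, K = 24 * (2 ^+ e * 2 ^+ e) * c ^+ 33 by eexists.
(* Chosen after [w]: it ensures 4w <= t, hence m <= N, and makes the failure of sparsity have
   probability at most eps/2. *)
have [t0 ht0] := exists_nat_ge (20 + c + 2 * K1 / eps).
exists (t0 ^ 10)%N => n hn.
have D0r : 0 < D%:R :> rat by rewrite ltr0n.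
have K20 : 0 <= K2 by rewrite eK2 !mulr_ge0 ?exprn_ge0 ?ler0n.
have K2e : 0 <= 2 * K2 / eps by rewrite divr_ge0 ?mulr_ge0 // ltW.
have DL : 0 <= 2 * D%:R * L%:R :> rat by rewrite !mulr_ge0 ?ler0n.
have w1 : (1 <= w)%N by rewrite -(ler_nat rat); clear -hw K2e DL; lra.
have w1r : 1 <= w%:R :> rat by rewrite ler1n.
have c4 : 1 <= c by rewrite ec ez; clear -w1r; lra.
have c0 : 0 <= c := le_trans ler01 c4.
have K10 : 0 <= K1.
  rewrite eK1; apply: mulr_ge0; last exact: exprn_ge0.
  by apply: mulr_ge0; [exact: ler0n | apply: mulr_ge0; rewrite exprn_ge0].
have K1e : 0 <= 2 * K1 / eps by rewrite divr_ge0 ?mulr_ge0 // ltW.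
have t20 : (20 <= t0)%N by rewrite -(ler_nat rat); clear -ht0 c4 K1e; lra.
have tw : (4 * w <= t0)%N by rewrite -(ler_nat rat) natrM -ez -ec; clear -ht0 K1e; lra.
have [t [tt0 tn nt]] := root10 hn (leq_trans (isT : 0 < 20)%N t20).
have t1 : (0 < t)%N by apply: leq_trans tt0; apply: leq_trans t20.
have texp a b' : (a <= b')%N -> (t ^ a <= t ^ b')%N by move=> ab; rewrite leq_pexp2l.
have n20 : (20 <= n)%N.
  by apply: leq_trans t20 _; apply: leq_trans tt0 _; apply: leq_trans tn; apply: (texp 1%N).
have N0 : (0 < nedges n)%N.
  have : (0%N, 1%N) \in Kedges n by rewrite mem_Kedges /=; apply: leq_trans n20.
  by rewrite -index_mem; apply: leq_ltn_trans.
pose k0 := Ordinal N0; have NE := nedgesE k0.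
have n4N : (n * n <= 4 * nedges n)%N.
  rewrite -[4%N]/(2 * 2)%N -mulnA NE mulnCA leq_mul2l; apply/orP; right.
  by clear -n20; lia.
have t20N : (t ^ 20 <= 4 * nedges n)%N.
  apply: leq_trans n4N; have -> : (t ^ 20 = t ^ 10 * t ^ 10)%N by rewrite -expnD.
  exact: leq_mul.
pose m := (w * t ^ 13)%N.
have mN : (m <= nedges n)%N.
  rewrite -(leq_pmul2l (m := 4)) // /m mulnA; apply: leq_trans t20N.
  apply: leq_trans (texp 14%N 20%N isT); rewrite [X in (_ <= X)%N]expnS leq_mul2r.
  by rewrite (leq_trans tw) ?orbT.
have m20 : (20 <= m)%N.
  apply: leq_trans t20 _; apply: leq_trans tt0 _.
  by apply: leq_trans (texp 1%N 13%N isT) _; rewrite leq_pmull.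
have N10 : (10 <= nedges n)%N.
  by move: n4N n20; clear; nia.
(* From t^20 <= 4N one gets w t^13 / N <= 4w / t^7, which is why c = 4w. *)
have mc : m%:R / (nedges n)%:R <= c / t%:R ^+ 7 :> rat.
  rewrite ler_pdivrMr ?ltr0n // mulrAC ler_pdivlMr ?exprn_gt0 ?ltr0n //.
  rewrite ec ez -!natrX -!natrM ler_nat /m -mulnA -expnD mulnAC [X in (_ <= X)%N]mulnC.
  by rewrite leq_mul2l t20N orbT.
have mul := mu_lower k0 hD (erefl m) m20 (leq_trans (isT : 14 <= 20)%N n20) N10 nt.
exists k0, m.
have mu0 : 0 < mu n m.
  rewrite -(pmulr_rgt0 _ D0r); apply: lt_le_trans mul.
  by rewrite ltr0n expn_gt0 w1.
have w10 : w%:R <= (w ^ 10)%:R :> rat.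
  by rewrite ler_nat -{1}[w]expn1 leq_pexp2l.
have hL : 2 * L%:R <= mu n m.
  rewrite -(ler_pM2l D0r); apply: le_trans mul; apply: le_trans w10.
  by clear -hw K2e; lra.
have p1 := pr_not_sparse k0 mN t1 c4 nt mc he.
have p2 := chebyshev k0 mN t1 c4 nt mc hb mu0 hL.
have p12 : pr (fun s => ~~ sparseb m s || (ncopies k0 m s <= L%:R)) <=
    pr (fun s : {perm 'I_(nedges n)} => ~~ sparseb m s) + pr (fun s => ncopies k0 m s <= L%:R).
  rewrite !pr_sum -mulrDl ler_wpM2r ?invr_ge0 ?ler0n // -big_split /=.
  apply: ler_sum => s _; case: (~~ _) => /=; last by rewrite add0r.
  by rewrite lerDl ler0n.
apply: le_trans p12 _.
have tr0 : 0 < t%:R :> rat by rewrite ltr0n.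
have b1 : 24 * (2 ^+ e * 2 ^+ e) * c ^+ 33 / t%:R <= eps / 2.
  rewrite -eK1 ler_pdivrMr // mulrAC ler_pdivlMr // mulrC -ler_pdivrMl //.
  have : t0%:R <= t%:R :> rat by rewrite ler_nat.
  by rewrite mulrC; clear -ht0 c4; lra.
have b2 : 4 * (b%:R ^+ 14 * c ^+ 19) / mu n m ^+ 2 <= eps / 2.
  have wp : 0 < w%:R :> rat by rewrite ltr0n.
  have b14 : 0 <= b%:R ^+ 14 :> rat by rewrite exprn_ge0 ?ler0n.
  have f19 : 0 <= z ^+ 19 by rewrite exprn_ge0.
  have cE : c ^+ 19 = z ^+ 19 * w%:R ^+ 19 by rewrite ec exprMn.
  rewrite natrX in mul.
  apply: le_trans (_ : K2 / w%:R <= _).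
    by rewrite cE eK2; exact: ratio_bound b14 f19 wp mu0 mul.
  rewrite ler_pdivrMr // mulrAC ler_pdivlMr // mulrC -ler_pdivrMl //.
  by rewrite mulrC; clear -hw DL; lra.
by apply: le_trans (lerD p1 p2) _; apply: le_trans (lerD b1 b2) _; clear; lra.
Qed.

(** Outside an event of probability at most eps, G_m is sparse and has more than L >= 7^7 embeddings
    of DD, hence two copies. *)
Lemma whp_of_good (E : forall n, {perm 'I_(nedges n)} -> bool) :
  (forall n (k0 : 'I_(nedges n)) m (s : {perm 'I_(nedges n)}),
     sparse (Gproc s m) 23 -> contains_k DD 2 (Gproc s m) -> E n s) -> whp E.
Proof.
move=> hE eps eps0.
have [L hL] : exists L, (7 ^ 7 <= L)%N by eexists; apply: leqnn.
have [N0 h] := good_whp L eps0; exists N0 => n /h[k0 [m bad]].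
rewrite -/(pr (E n)) lerBlDr; apply: le_trans (_ : pr (E n) +
  pr (fun s => ~~ sparseb m s || (ncopies k0 m s <= L%:R)) <= _); last by rewrite lerD2l.
have P0 := card_perms_gt0 n.
rewrite !pr_sum -mulrDl ler_pdivlMr // mul1r -big_split /=.
rewrite -sum1_card natr_sum; apply: ler_sum => s _.
case: (boolP (sparseb m s)) => [/(sparsebP m s) sp|_] /=; last by rewrite lerDr ler0n.
case: (leP (ncopies k0 m s) L%:R) => [_|lt]; first by rewrite lerDr ler0n.
by rewrite (hE n k0 m s sp) ?lerDl ?ler0n // (contains_2_of_many hL lt).
Qed.

End Asymptotics.

Theorem theorem4 :
  whp (fun n s => tau Maker1 s == tau (contains_k DD 1) s) /\
  whp (fun n s => tau Maker2 s == tau (contains_k DD 2) s).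
Proof.
split; apply: whp_of_good => n k0 m s sp two; apply/eqP.
  exact: tau_Maker1 k0 _ _ sp two.
exact: tau_Maker2 k0 _ _ sp two.
Qed.
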